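(* Fix $\alpha\in(0,1)$ and let $\rho=\alpha(1-\alpha)$. Let $P_1=\mathbb G(m_1,\mathsf K)$ and $P_2=\mathbb G(m_2,\mathsf K)$ be Gaussian measures on an infinite-dimensional real separable Hilbert space $H$ with common covariance operator $\mathsf K$, whose eigenvalues satisfy $\lambda_j>0$ for every $j$, and let $m_\Delta=m_2-m_1$. Then the following statements are equivalent: \begin{enumerate} \item $P_1\perp P_2$ (mutual singularity); \item $\Delta_q\longrightarrow\infty$ as $q\to\infty$; \item $\mathcal A_q^{(4)}/\mathcal A_q^{(F)}\longrightarrow1$ as $q\to\infty$. \end{enumerate} Equivalently, $P_1\perp P_2\iff\mathcal A_q^{(4)}\sim\mathcal A_q^{(F)}$ as $q\to\infty$.
   Context: For $f,g\in H$, $f\otimes g$ is the rank-one operator $(f\otimes g)(h)=\langle h,g\rangle f$. $\mathbb G(m,\mathsf K)$ is the Gaussian measure on $H$ with mean $m\in H$ and covariance operator $\mathsf K$ (self-adjoint, positive, trace class). Fix an orthonormal basis $\{\gamma_j\}_{j\ge1}$ of $H$ with $\mathsf K\gamma_j=\lambda_j\gamma_j$, $\lambda_1\ge\lambda_2\ge\cdots$. Write $m_\Delta=\sum_j\nu_j\gamma_j$ and $\widetilde\nu_j=\nu_j/\sqrt{\lambda_j}$, and define \[ \Delta_q=2\rho\sum_{j=1}^q\widetilde\nu_j^{\,2}+\rho(1-3\rho)\sum_{j=1}^q\widetilde\nu_j^{\,4}. \] Set $\pi_1=\alpha$, $\pi_2=1-\alpha$, $a_1=-(1-\alpha)$, $a_2=\alpha$.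 Let $X_\ell\sim\mathbb G(m_\ell,\mathsf K)$, $\ell=1,2$, and $\zeta_{\ell j}=\langle X_\ell-m_\ell,\gamma_j\rangle_H/\sqrt{\lambda_j}$; for each $\ell$, these are independent standard Gaussian variables. For $q\ge1$ define \[ \widetilde{\mathsf V}^{(2)}_{\ell,q}=\sum_{j,k=1}^{q}\bigl(\zeta_{\ell j}\zeta_{\ell k}+a_\ell^2\widetilde\nu_j\widetilde\nu_k\bigr)(\gamma_j\otimes\gamma_k), \] \[ \widetilde{\mathsf V}_q^{(4)}=\sum_{\ell=1}^2\pi_\ell\,\mathbb E\bigl(\widetilde{\mathsf V}^{(2)}_{\ell,q}\otimes\widetilde{\mathsf V}^{(2)}_{\ell,q}\bigr),\qquad \mathsf F_q=\sum_{\ell=1}^2\pi_\ell\,\bigl(\mathbb E\widetilde{\mathsf V}^{(2)}_{\ell,q}\bigr)\otimes\bigl(\mathbb E\widetilde{\mathsf V}^{(2)}_{\ell,q}\bigr). \] Let $\kappa_{j,q}$ and $\kappa^{(F)}_{j,q}$ ($1\le j\le q$) be the completely diagonal coefficients of $\widetilde{\mathsf V}_q^{(4)}$ and $\mathsf F_q$, i.e. the coefficients of $\gamma_j\otimes\gamma_j\otimes\gamma_j\otimes\gamma_j$: \[ \kappa_{j,q}=\sum_{\ell=1}^2\pi_\ell\,\mathbb E\bigl[(\zeta_{\ell j}^2+a_\ell^2\widetilde\nu_j^{\,2})^2\bigr],\qquad \kappa^{(F)}_{j,q}=\sum_{\ell=1}^2\pi_\ell\,\bigl(\mathbb E[\zeta_{\ell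 j}^2+a_\ell^2\widetilde\nu_j^{\,2}]\bigr)^2 . \] The aggregated spectral functionals are \[ \mathcal A_q^{(4)}=3+\sum_{j=1}^q(\kappa_{j,q}-3),\qquad \mathcal A_q^{(F)}=1+\sum_{j=1}^q(\kappa^{(F)}_{j,q}-1). \] For sequences, $x_q\sim y_q$ means $x_q/y_q\to1$ as $q\to\infty$. *)

(* Defs.v *)
From HB Require Import structures.
From mathcomp Require Export all_boot all_order all_algebra.
From mathcomp Require Export all_classical all_reals all_analysis.
Export Order.TTheory GRing.Theory Num.Theory.
Export numFieldNormedType.Exports.

Set Implicit Arguments.
Unset Strict Implicit.
Unset Printing Implicit Defensive.

Local Open Scope classical_set_scope.
Local Open Scope ring_scope.

Section Hilbert.
Context {R : realType} {H : completeNormedModType R}.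
Variable ip : {dot H for idfun}.
Implicit Types (g : nat -> H) (K : {linear H -> H}) (x y : H).

(* With [H] complete, this makes [(H, ip)] a real Hilbert space. *)
Definition inner_product_norm : Prop := forall x, `|x| ^+ 2 = ip x x.

(* The index set is [nat]: a Hilbert space with such a basis is separable and
   infinite-dimensional. *)
Definition orthonormal_basis g : Prop :=
  (forall i j, ip (g i) (g j) = (i == j)%:R) /\
  (forall x, series (fun j => ip x (g j) *: g j) @ \oo --> x).

Definition self_adjoint K : Prop := forall x y, ip (K x) y = ip x (K y).

Definition positive_operator K : Prop := forall x, 0 <= ip (K x) x.

(* For a positive operator [K], [|K| = K], so the trace norm of [K] is the sum
   of the [ip (K (g j)) (g j)] over an orthonormal basis [g]. *)
Definition positive_trace_class K : Prop :=
  forall g, orthonormal_basis g -> cvgn (series (fun j => ip (K (g j)) (g j))).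

Definition covariance_operator K : Prop :=
  [/\ continuous K, self_adjoint K, positive_operator K
    & positive_trace_class K].

End Hilbert.

Notation borel H := (g_sigma_algebraType (@open H)).

Section Gaussian.
Context {R : realType}.

(* [normal_prob m 0] is not the point mass at [m]: in the library it is a
   uniform distribution. *)
Definition normal_law (m s : R) : set R -> \bar R :=
  if s == 0 then \d_m else normal_prob m s.

Context {H : completeNormedModType R}.
Variables (ip : {dot H for idfun}) (P : probability (borel H) R).

Definition gaussian_measure : Prop :=
  forall h : H, exists m s : R, forall A : set R, measurable A ->
    P [set x : H | A (ip x h)] = normal_law m s A.

Definition has_mean (m : H) : Prop :=
  forall h : H, ('E_P[fun x : H => ip x h])%E = (ip m h)%:E.

Definition has_covariance (K : {linear H -> H}) : Prop :=
  forall f h : H,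
    covariance P (fun x : H => ip x f) (fun x : H => ip x h) = (ip (K f) h)%:E.

Definition gaussian (m : H) (K : {linear H -> H}) : Prop :=
  [/\ gaussian_measure, has_mean m & has_covariance K].

End Gaussian.

Definition mutually_singular d (T : measurableType d) (R : realType)
    (P Q : probability T R) : Prop :=
  exists A : set T, [/\ measurable A, P A = 0%E & Q (~` A) = 0%E].

Definition asymp_equiv (R : realType) (x y : nat -> R) : Prop :=
  x q / y q @[q --> \oo] --> (1 : R).

(* The classes 1 and 2 are the elements 0 and 1 of ['I_2], and bases and
   eigenvalues are indexed from 0. *)
Section Functionals.
Context {R : realType} {H : completeNormedModType R}.
Variable ip : {dot H for idfun}.
Variables (alpha : R) (gamma : nat -> H) (lam : nat -> R) (m : 'I_2 -> H).

Definition rho : R := alpha * (1 - alpha).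

Definition prior (l : 'I_2) : R := if l == 0 then alpha else 1 - alpha.

Definition centering (l : 'I_2) : R := if l == 0 then - (1 - alpha) else alpha.

Definition nu (j : nat) : R := ip (m 1 - m 0) (gamma j).

Definition nu_std (j : nat) : R := nu j / Num.sqrt (lam j).

Definition Delta (q : nat) : R :=
  2 * rho * \sum_(j < q) nu_std j ^+ 2 +
  rho * (1 - 3 * rho) * \sum_(j < q) nu_std j ^+ 4.

Context {d : measure_display} {T : measurableType d}.
Variables (Pr : probability T R) (X : 'I_2 -> {RV Pr >-> borel H}).

Definition zeta (l : 'I_2) (j : nat) (w : T) : R :=
  ip ((X l w : H) - m l) (gamma j) / Num.sqrt (lam j).

(* For [j < q], the coefficient of gamma_j (x) gamma_j in the operator
     V2_{l,q} = sum_(j, k < q) (zeta_j zeta_k + a_l^2 nu_j nu_k)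
                  gamma_j (x) gamma_k
   with [nu] standardized. Below, [kappa j] and [kappaF j] are the coefficients
   of gamma_j^{(x) 4} in sum_l pi_l E(V2_{l,q} (x) V2_{l,q}) and in
   sum_l pi_l E(V2_{l,q}) (x) E(V2_{l,q}); they do not depend on q. *)
Definition V2_diag (l : 'I_2) (j : nat) (w : T) : R :=
  zeta l j w ^+ 2 + centering l ^+ 2 * nu_std j ^+ 2.

Definition kappa (j : nat) : R :=
  \sum_(l < 2) prior l * fine 'E_Pr[fun w => (V2_diag l j w ^+ 2)%R]%E.

Definition kappaF (j : nat) : R :=
  \sum_(l < 2) prior l * (fine 'E_Pr[V2_diag l j]%E) ^+ 2.

Definition A4 (q : nat) : R := 3 + \sum_(j < q) (kappa j - 3).

Definition AF (q : nat) : R := 1 + \sum_(j < q) (kappaF j - 1).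

End Functionals.

(* Main.v *)
From HB Require Import structures.
Require Import Defs.
From mathcomp Require Import measurable_realfun ring lra.

(* With v_j the standardized coordinates of m_1 - m_0, the Gaussian moments
   1 and 3 give A4 = 3 + Delta and AF = 1 + Delta, so the ratio is
   1 + 2 / (1 + Delta); and Delta tends to infinity exactly when
   S_q = sum_(j < q) v_j ^ 2 does.

   Let L_q be the Gaussian likelihood ratio of the first q coordinates.  If S_q
   diverges, Chernoff's bound gives P_0 (L_q >= 1) <= exp (- S_q / 8) and
   P_1 (L_q < 1) <= exp (- S_q / 8), and Borel-Cantelli along a subsequence
   separates the two measures.  If S_q <= M, then P_1 = L_q P_0 on the events
   depending on the first q coordinates, because both sides have the same
   moment generating function; since E_0 (L_q ^ 2) = exp (S_q), AM-GM gives
   P_1 B <= (t / 2) P_0 B + exp M / (2 t) for all such B, uniformly in q.  These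
   events form an algebra generating the Borel sets, so approximating a
   separating event by them contradicts this bound for t large. *)

Set Implicit Arguments.
Unset Strict Implicit.
Unset Printing Implicit Defensive.

Local Open Scope classical_set_scope.
Local Open Scope ring_scope.

(** * Elementary real sequences *)

(** Equality of moment generating functions is turned into equality of measures without inverting a
    transform. The identity between the two integrals is given for exponentials of linear
    functionals, and it survives linear combinations and limits dominated by sums of exponentials.
    Half-space indicators are within reach of these operations: derivatives of exponentials give
    polynomial factors, power series give sines and cosines, and polynomials in a sine converge to
    the indicator of its sign. The bounded functions allowed as factors are closed under products,
    which carries the identity on to the generated sigma-algebra. The measures are compared on
    finitely many coordinates only, so no density on the whole space has to be built. The bound with
    a free t is affine in [P_0 B] and its constant depends on M alone; hence it can be tested on
    cylinder events close to a separating one. *)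

Section real_sequences.
Context {R : realType}.
Implicit Types (x y r : R) (n k : nat).

Lemma expR_sub1_le x : expR x - 1 <= x * expR x.
Proof.
have := expR_ge1Dx (- x); rewrite expRN.
have e0 := expR_gt0 x.
rewrite -(ler_pM2r e0) mulVf ?gt_eqF// mulrDl mul1r => h; lra.
Qed.

Lemma norm_expR_sub1_le x : `|expR x - 1| <= `|x| * expR `|x|.
Proof.
have h1 := expR_ge1Dx x; have h2 := expR_sub1_le x.
have [x0|x0] := leP 0 x.
  by rewrite ger0_norm ?[`|x|]ger0_norm//; lra.
have e1 : expR x <= 1 by rewrite -expR0 ler_expR ltW.
rewrite ler0_norm; last lra.
have : 1 <= expR `|x| by rewrite -expR0 ler_expR.
rewrite [`|x|]ltr0_norm// => h3.
have : 0 <= (- x) * (expR (- x) - 1) by rewrite mulr_ge0; lra.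
move=> h; lra.
Qed.

Lemma cvg_harmonicZ x : x / k.+1%:R @[k --> \oo] --> (0 : R).
Proof.
rewrite -[X in _ --> X](mulr0 x); apply: cvgM; first exact: cvg_cst.
exact: cvg_harmonic.
Qed.

(** Difference quotient of the exponential with step 1/(k+1). In [expcl_pow] it produces one more
    factor [Y v] as a limit of combinations of exponentials; [norm_expR_quotient_le] is the bound
    uniform in k that dominates this limit. *)
Lemma cvg_expR_quotient y :
  k.+1%:R * (expR (y / k.+1%:R) - 1) @[k --> \oo] --> y.
Proof.
apply: (@squeeze_cvgr _ _ _ _ (cst y) (fun k => y * expR (y / k.+1%:R))).
- apply: nearW => k /=; have k0 : (0 : R) < k.+1%:R by [].
  have k0' : (k.+1%:R : R) != 0 by rewrite gt_eqF.
  apply/andP; split.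
    rewrite mulrC -ler_pdivrMr// lerBrDl; exact: expR_ge1Dx.
  rewrite mulrC -ler_pdivlMr// mulrAC; exact: expR_sub1_le.
- exact: cvg_cst.
- rewrite -[X in _ --> X]mulr1; apply: cvgM; first exact: cvg_cst.
  rewrite -[X in _ --> X]expR0.
  by apply: continuous_cvg; [exact: continuous_expR|exact: cvg_harmonicZ].
Qed.

Lemma norm_expR_quotient_le y k :
  `|k.+1%:R * (expR (y / k.+1%:R) - 1)| <= `|y| * expR `|y|.
Proof.
have k0 : (0 : R) < k.+1%:R by [].
have k0' : (k.+1%:R : R) != 0 by rewrite gt_eqF.
rewrite normrM (gtr0_norm k0) mulrC -ler_pdivlMr//.
apply: (le_trans (norm_expR_sub1_le _)).
have e : `|y / k.+1%:R| = `|y| / k.+1%:R.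
  by rewrite normf_div (gtr0_norm k0).
rewrite e mulrAC ler_pM2r ?invr_gt0//.
rewrite ler_wpM2l// ler_expR ler_pdivrMr//.
by rewrite ler_peMr// ler1n.
Qed.

Lemma series_exp_coeff_le x n : 0 <= x -> series (exp_coeff x) n <= expR x.
Proof.
move=> x0; apply: nondecreasing_cvgn_le; last exact: is_cvg_series_exp_coeff.
move=> a b ab; rewrite /series /= -(subnKC ab) /index_iota !subn0 iotaD.
rewrite big_cat /= lerDl sumr_ge0// => i _; exact: exp_coeff_ge0.
Qed.

Lemma exprn_le_expR x n : 0 <= x -> x ^+ n <= n`!%:R * expR x.
Proof.
move=> x0; have f0 : (0 : R) < n`!%:R by rewrite ltr0n fact_gt0.
rewrite mulrC -ler_pdivrMr//; apply: le_trans (series_exp_coeff_le n.+1 x0).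
rewrite /series /= big_nat_recr//= lerDr sumr_ge0// => i _.
exact: exp_coeff_ge0.
Qed.

(** Partial sums of sine and cosine are not bounded uniformly in x, but they stay below an
    exponential, which is all that dominated convergence asks for. *)
Lemma norm_series_trig_le (c : nat -> R) x n :
  (forall i, `|c i| <= exp_coeff `|x| i) -> `|series c n| <= expR `|x|.
Proof.
move=> h; rewrite (le_trans _ (series_exp_coeff_le n (normr_ge0 x)))//.
by rewrite /series/= (le_trans (ler_norm_sum _ _ _))// ler_sum.
Qed.

Lemma norm_sin_coeff_le x i : `|sin_coeff x i| <= exp_coeff `|x| i.
Proof.
rewrite /sin_coeff /exp_coeff /= !normrM normrX normrX normrV; last first.
  by rewrite unitfE pnatr_eq0 -lt0n fact_gt0.
rewrite normrN1 expr1n mulr1 !normr_nat -mulrA ler_piMl//.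
by case: odd.
Qed.

Lemma norm_cos_coeff_le x i : `|cos_coeff x i| <= exp_coeff `|x| i.
Proof.
rewrite /cos_coeff /exp_coeff /= !normrM normrX normrX normrV; last first.
  by rewrite unitfE pnatr_eq0 -lt0n fact_gt0.
rewrite normrN1 expr1n mulr1 !normr_nat -mulrA ler_piMl//.
by case: odd.
Qed.

Lemma bernoulli_ge (t : R) n : 0 <= t <= 1 -> 1 - n%:R * t <= (1 - t) ^+ n.
Proof.
move=> /andP[t0 t1]; elim: n => [|n IHn]; first by rewrite mul0r subr0.
rewrite exprS; apply: (@le_trans _ _ ((1 - t) * (1 - n%:R * t))).
  have h : 0 <= n%:R * t * t by rewrite !mulr_ge0.
  rewrite -natr1; lra.
by rewrite ler_wpM2l// subr_ge0.
Qed.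

(** Induction through [(1 - t) * (1 + (n + 1) * t) <= 1 + n * t]. The two Bernoulli bounds treat the
    two sides of the threshold in [cvg_step_polynomial]. *)
Lemma bernoulli_inv_le (t : R) n : 0 <= t <= 1 ->
  (1 - t) ^+ n * (1 + n%:R * t) <= 1.
Proof.
move=> /andP[t0 t1]; elim: n => [|n IHn]; first by rewrite mul0r addr0 mulr1.
rewrite exprS -mulrA mulrCA; apply: le_trans IHn.
rewrite ler_wpM2l// ?exprn_ge0 ?subr_ge0//.
have h : 0 <= n%:R * t * t by rewrite !mulr_ge0.
have h' : 0 <= t * t by rewrite mulr_ge0.
rewrite -natr1; lra.
Qed.

Lemma cvg_natr_geometric (r : R) : 0 <= r < 1 ->
  n%:R * r ^+ n @[n --> \oo] --> (0 : R).
Proof.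
(* With [r = s ^ 2], one power [s ^ n] absorbs the factor n, since [n * s ^ n] is at most the
   geometric sum of the [s ^ i], hence at most 1/(1-s); the other power tends to 0. *)
move=> /andP[r0 r1]; pose s := Num.sqrt r.
have s0 : 0 <= s by exact: sqrtr_ge0.
have s1 : s < 1 by rewrite -[ltRHS]sqrtr1 ltr_sqrt.
have sr : s ^+ 2 = r by rewrite sqr_sqrtr.
have nle n : n%:R * s ^+ n <= (1 - s)^-1.
  rewrite -[leRHS]mul1r ler_pdivlMr ?subr_gt0//.
  apply: (@le_trans _ _ ((1 - s) * \sum_(i < n) s ^+ i)).
    rewrite mulrC ler_wpM2l ?subr_ge0 ?(ltW s1)//.
    have -> : n%:R * s ^+ n = \sum_(i < n) s ^+ n.
      by rewrite sumr_const card_ord mulr_natl.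
    apply: ler_sum => i _.
    by rewrite ler_wiXn2l ?(ltW s1) ?(ltnW (ltn_ord i))//.
  have := subrX1 s n; rewrite -opprB -(opprB s) mulNr => /(congr1 -%R).
  by rewrite opprK => <-; rewrite lerBlDr lerDl exprn_ge0.
apply: (@squeeze_cvgr _ _ _ _ (cst 0) (fun n => (1 - s)^-1 * s ^+ n)).
- apply: nearW => n; rewrite mulr_ge0 ?exprn_ge0//=.
  by rewrite -sr -exprM mulnC muln2 -addnn exprD mulrA ler_wpM2r ?exprn_ge0.
- exact: cvg_cst.
- rewrite -[X in _ --> X](mulr0 (1 - s)^-1); apply: cvgM; first exact: cvg_cst.
  by apply: cvg_expr; rewrite ger0_norm.
Qed.

(* The exponent [n * 2 ^ n] beats the value [2 ^- n] of [x ^+ n] at the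
   threshold [x = 1/2], so that the limit is a strict indicator. *)
Lemma cvg_step_polynomial x : 0 <= x <= 1 ->
  (1 - x ^+ n) ^+ (n * 2 ^ n) @[n --> \oo] --> ((x < 1 / 2)%R%:R : R).
Proof.
move=> /andP[x0 x1].
have xn n : 0 <= x ^+ n <= 1 by rewrite exprn_ge0//= exprn_ile1.
have E n : (n * 2 ^ n)%:R * x ^+ n = n%:R * (2 * x) ^+ n.
  by rewrite natrM natrX exprMn mulrA.
have [xlt|xge] := ltP x (1 / 2) => /=.
  apply: (@squeeze_cvgr _ _ _ _ (fun n => 1 - n%:R * (2 * x) ^+ n) (cst 1)).
  - apply: nearW => n; rewrite -E bernoulli_ge//=.
    have /andP[a b] := xn n.
    by rewrite exprn_ile1// ?subr_ge0// lerBlDr lerDl.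
  - rewrite -[X in _ --> X]subr0; apply: cvgB; first exact: cvg_cst.
    apply: cvg_natr_geometric; rewrite mulr_ge0//=.
    by rewrite mulrC -ltr_pdivlMr.
  - exact: cvg_cst.
apply: (@squeeze_cvgr _ _ _ _ (cst 0) (fun n => n.+1%:R^-1)).
- apply: nearW => n /=; have /andP[a b] := xn n.
  rewrite exprn_ge0 ?subr_ge0//=.
  rewrite -[leRHS]mul1r ler_pdivlMr//.
  apply: le_trans (bernoulli_inv_le (n * 2 ^ n) (xn n)).
  rewrite ler_wpM2l ?exprn_ge0 ?subr_ge0// -natr1 addrC lerD2l E.
  by rewrite ler_peMr// exprn_ege1// mulrC -ler_pdivrMr.
- exact: cvg_cst.
- exact: cvg_harmonic.
Qed.

(** As soon as |x/(k+1)| < pi, the sine has the sign of x. The rescaling pushes the period to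
    infinity, so that sign conditions on sines give half-lines in [multiplier_lt]. *)
Lemma cvg_sin_sign x :
  (sin (x / k.+1%:R) < 0)%R%:R @[k --> \oo] --> ((x < 0)%R%:R : R).
Proof.
apply: cvg_near_cst; near=> k.
have k0 : (0 : R) < k.+1%:R by [].
have : `|x / k.+1%:R| < pi.
  near: k; move/cvgrPdist_lt: (cvg_harmonicZ x) => /(_ pi (pi_gt0 R)).
  by apply: filterS => k; rewrite sub0r normrN.
rewrite ltr_norml => /andP[h1 h2].
have [x0|x0|->] := ltgtP x 0.
- have : 0 < sin (- (x / k.+1%:R)).
    by apply: sin_gt0_pi; rewrite -mulNr divr_gt0 ?oppr_gt0//= mulNr ltrNl.
  by rewrite sinN oppr_gt0 => ->.
- have : 0 < sin (x / k.+1%:R).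
    by apply: sin_gt0_pi; rewrite divr_gt0.
  by move=> /ltW; rewrite leNgt => /negbTE ->.
- by rewrite mul0r sin0 ltxx.
Unshelve. all: by end_near. Qed.

End real_sequences.

(** * The moment generating function determines the law *)

Section real_dominated_convergence.
Context d (T : measurableType d) (R : realType).
Variable mu : {measure set T -> \bar R}.

Lemma dominated_cvg_real (f_ : nat -> T -> R) (f g : T -> R) :
  (forall n, measurable_fun setT (f_ n)) ->
  (forall x, f_ n x @[n --> \oo] --> f x) ->
  mu.-integrable setT (EFin \o g) ->
  (forall n x, `|f_ n x| <= g x) ->
  [/\ measurable_fun setT f, mu.-integrable setT (EFin \o f) &
   (\int[mu]_x (f_ n x)%:E)%E @[n --> \oo] --> (\int[mu]_x (f x)%:E)%E].
Proof.
move=> mf_ f_f ig f_g.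
have mf : measurable_fun setT f.
  by apply: (measurable_fun_cvg mf_) => x _; exact: f_f.
have [] := @dominated_convergence _ _ _ mu setT measurableT
  (fun n x => (f_ n x)%:E) (EFin \o f) (EFin \o g).
- by move=> n; apply/measurable_EFinP; exact: mf_.
- exact/measurable_EFinP.
- apply: aeW => x _; apply/cvg_EFin; first exact: nearW.
  exact: f_f.
- exact: ig.
- by apply: aeW => x n _ /=; rewrite lee_fin f_g.
by move=> ? _ ?; split.
Qed.

End real_dominated_convergence.

Section mgf_determines_law.
Context d (T : measurableType d) (R : realType).
Variables (mu nu : {measure set T -> \bar R}) (L : T -> R).
Context (V : lmodType R) (Y : V -> T -> R).
Hypothesis mL : measurable_fun setT L.
Hypothesis YD : forall u v x, Y (u + v) x = Y u x + Y v x.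
Hypothesis YZ : forall a v x, Y (a *: v) x = a * Y v x.
Hypothesis mY : forall v, measurable_fun setT (Y v).
Hypothesis imu : forall v, mu.-integrable setT (EFin \o (fun x => expR (Y v x))).
Hypothesis inu : forall v,
  nu.-integrable setT (EFin \o (fun x => L x * expR (Y v x))).
Hypothesis mgfE : forall v, (\int[mu]_x (expR (Y v x))%:E =
  \int[nu]_x (L x * expR (Y v x))%:E)%E.
Hypothesis L0 : forall x, 0 <= L x.

Let Y0 x : Y 0 x = 0.
Proof. by rewrite -(scale0r (0 : V)) YZ mul0r. Qed.

(** The admissible bounds for limits: finite sums of exponentials are integrable under [mu], and
    under [nu] once multiplied by [L]. *)
Let dominator (s : seq V) x := \sum_(v <- s) expR (Y v x).

(* A limit-closed stand-in for the [L ^ 2] closure of the span of the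
   exponentials [expR (Y v)]; on it the identity between the two integrals is
   stable. *)
Inductive expcl : (T -> R) -> Prop :=
| expcl_exp v : expcl (fun x => expR (Y v x))
| expcl_lin a f g : expcl f -> expcl g -> expcl (fun x => a * f x + g x)
| expcl_lim (f_ : nat -> T -> R) f C s : (forall n, expcl (f_ n)) ->
    (forall n x, `|f_ n x| <= C * dominator s x) ->
    (forall x, f_ n x @[n --> \oo] --> f x) -> expcl f.

Let expcl_eq f g : f =1 g -> expcl f -> expcl g.
Proof. by move=> /funext ->. Qed.

Let dominator_integrable C s :
  mu.-integrable setT (EFin \o (fun x => C * dominator s x)) /\
  nu.-integrable setT (EFin \o (fun x => L x * (C * dominator s x))).
Proof.
split.
  have -> : EFin \o (fun x => C * dominator s x) =
     (fun x => C%:E * \sum_(v <- s) (expR (Y v x))%:E)%E.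
    by apply/funext => x /=; rewrite EFinM sumEFin.
  apply: integrableZl => //; apply: integrable_sum => // v _; exact: imu.
have -> : EFin \o (fun x => L x * (C * dominator s x)) =
     (fun x => C%:E * \sum_(v <- s) (L x * expR (Y v x))%:E)%E.
  by apply/funext => x /=; rewrite mulrCA EFinM mulr_sumr sumEFin.
apply: integrableZl => //; apply: integrable_sum => // v _; exact: inu.
Qed.

Lemma expcl_integral f : expcl f ->
  [/\ measurable_fun setT f, mu.-integrable setT (EFin \o f),
      nu.-integrable setT (EFin \o (fun x => L x * f x)) &
      (\int[mu]_x (f x)%:E = \int[nu]_x (L x * f x)%:E)%E].
Proof.
elim=> [v|a {}f g _ [mf if1 if2 fE] _ [mg ig1 ig2 gE]|f_ {}f C s _ IH f_le f_f].
- split => //; exact: measurableT_comp.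
- have E1 : EFin \o (fun x => a * f x + g x) =
      (fun x => a%:E * (f x)%:E + (g x)%:E)%E.
    by apply/funext => x /=; rewrite EFinD EFinM.
  have E2 : EFin \o (fun x => L x * (a * f x + g x)) =
      (fun x => a%:E * (L x * f x)%:E + (L x * g x)%:E)%E.
    by apply/funext => x /=; rewrite mulrDr mulrCA EFinD EFinM.
  split.
  + by apply: measurable_funD => //; apply: measurable_funM.
  + by rewrite E1; apply: integrableD => //; apply: integrableZl.
  + by rewrite E2; apply: integrableD => //; apply: integrableZl.
  + rewrite [LHS](_ : _ = \int[mu]_x (a%:E * (f x)%:E + (g x)%:E)%E)%E; last first.
      by rewrite -E1.
    rewrite [RHS](_ : _ =
       \int[nu]_x (a%:E * (L x * f x)%:E + (L x * g x)%:E)%E)%E; last first.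
      by rewrite -E2.
    rewrite integralD//; last exact: integrableZl.
    rewrite integralD//; last exact: integrableZl.
    by rewrite integralZl// integralZl// fE gE.
- have [idom1 idom2] := dominator_integrable C s.
  have [mf if1 cf1] := dominated_cvg_real
    (fun n => let: And4 m _ _ _ := IH n in m) f_f idom1 f_le.
  have mLf n : measurable_fun setT (fun x => L x * f_ n x).
    by apply: measurable_funM => //; have [] := IH n.
  have cL x : L x * f_ n x @[n --> \oo] --> L x * f x.
    by apply: cvgM; [exact: cvg_cst|exact: f_f].
  have leL n x : `|L x * f_ n x| <= L x * (C * dominator s x).
    by rewrite normrM ger0_norm// ler_wpM2l.
  have [mLf' if2 cf2] := dominated_cvg_real mLf cL idom2 leL.
  have E : (fun n => \int[mu]_x (f_ n x)%:E)%E =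
      (fun n => \int[nu]_x (L x * f_ n x)%:E)%E.
    by apply/funext => n; have [] := IH n.
  split => //; rewrite E in cf1.
  by rewrite -(cvg_lim (@ereal_hausdorff R) cf1) (cvg_lim _ cf2).
Qed.

(** The linear constructor always adds a second function and zero is not yet known to lie in
    [expcl]; hence the splitting [a = (a - 1) + 1]. *)
Let expcl_scale a f : expcl f -> expcl (fun x => a * f x).
Proof.
move=> ef; apply: (@expcl_eq (fun x => (a - 1) * f x + f x)).
  by move=> x; lra.
exact: expcl_lin.
Qed.

Let expcl_sum n (F : nat -> T -> R) : (forall i, expcl (F i)) ->
  expcl (fun x => \sum_(0 <= i < n) F i x).
Proof.
move=> eF; elim: n => [|n IHn].
  apply: (@expcl_eq (fun x => 0 * F 0 x)); last exact: expcl_scale.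
  by move=> x; rewrite big_geq// mul0r.
apply: (@expcl_eq (fun x => 1 * \sum_(0 <= i < n) F i x + F n x)).
  by move=> x; rewrite big_nat_recr//= mul1r.
exact: expcl_lin.
Qed.

Let expR_norm_le (y : R) : expR `|y| <= expR y + expR (- y).
Proof.
by have [y0|y0] := ger0P y; rewrite ?lerDl ?lerDr expR_ge0.
Qed.

(** Differentiation of the exponential in the direction v: the quotients only involve the exponents
    w and w + v/(k+1), which the induction hypothesis covers because it holds for every w. *)
Lemma expcl_pow n v w : expcl (fun x => Y v x ^+ n * expR (Y w x)).
Proof.
elim: n w => [|n IHn] w.
  by apply: (expcl_eq _ (expcl_exp w)) => x; rewrite expr0 mul1r.
pose f_ k x := Y v x ^+ n * expR (Y w x) *
  (k.+1%:R * (expR (Y v x / k.+1%:R) - 1)).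
(* With y = [Y v x], one factor exp |y| comes from |y|^(n+1) <= (n+1)! exp |y| and another from the
   quotient bound; exp (2|y|) is at most exp (2y) + exp (-2y), whence the vectors w + 2v and w -
   2v. *)
apply: (@expcl_lim f_ _ n.+1`!%:R [:: w + 2 *: v; w - 2 *: v]).
- move=> k; apply: (@expcl_eq (fun x =>
    k.+1%:R * (Y v x ^+ n * expR (Y (w + k.+1%:R^-1 *: v) x)) +
    (- k.+1%:R) * (Y v x ^+ n * expR (Y w x)))).
    move=> x; rewrite /f_ YD YZ expRD [_^-1 * Y v x]mulrC; ring.
  by apply: expcl_lin => //; apply: expcl_scale.
- move=> k x; rewrite /dominator big_cons big_seq1 /f_ !normrM normrX.
  rewrite [`|expR _|]ger0_norm ?expR_ge0// -normrM.
  have Yv : 0 <= `|Y v x| by [].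
  apply: (@le_trans _ _ (`|Y v x| ^+ n * expR (Y w x) *
      (`|Y v x| * expR `|Y v x|))).
    by rewrite ler_wpM2l ?norm_expR_quotient_le// mulr_ge0 ?expR_ge0 ?exprn_ge0.
  have -> : `|Y v x| ^+ n * expR (Y w x) * (`|Y v x| * expR `|Y v x|) =
    `|Y v x| ^+ n.+1 * (expR (Y w x) * expR `|Y v x|) by rewrite exprSr; ring.
  apply: (@le_trans _ _ (n.+1`!%:R * expR `|Y v x| *
      (expR (Y w x) * expR `|Y v x|))).
    by rewrite ler_wpM2r ?exprn_le_expR// mulr_ge0 ?expR_ge0.
  have -> : n.+1`!%:R * expR `|Y v x| * (expR (Y w x) * expR `|Y v x|) =
    n.+1`!%:R * (expR (Y w x) * expR (2 * `|Y v x|)).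
    by rewrite mulr2n mulrDl mul1r expRD; ring.
  rewrite ler_wpM2l// !YD -scaleNr !YZ mulNr !expRD -mulrDr ler_wpM2l ?expR_ge0//.
  by have := expR_norm_le (2 * Y v x); rewrite normrM ger0_norm.
- move=> x; rewrite exprSr mulrAC /f_; apply: cvgM; first exact: cvg_cst.
  exact: cvg_expR_quotient.
Qed.

(** Closure of [expcl] under products is not apparent from its constructors. Functions acting on it
    by multiplication compose, so they form an algebra; boundedness keeps the dominators valid. *)
Definition multiplier (s : T -> R) :=
  (exists C, forall x, `|s x| <= C) /\
  (forall f, expcl f -> expcl (fun x => s x * f x)).

Let dominator_ge0 s x : 0 <= dominator s x.
Proof. by apply: sumr_ge0 => v _; exact: expR_ge0. Qed.

(** Testing on exponentials suffices, because multiplication by a bounded function commutes with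
    linear combinations and with dominated limits. *)
Lemma multiplierP s : (exists C, forall x, `|s x| <= C) ->
  (forall v, expcl (fun x => s x * expR (Y v x))) -> multiplier s.
Proof.
move=> [C sC] sexp; split; first by exists C.
move=> f; elim=> [//|a {}f g _ IHf _ IHg|f_ {}f C' t _ IH f_le f_f].
  apply: (expcl_eq _ (expcl_lin a IHf IHg)) => x; ring.
apply: (@expcl_lim (fun n x => s x * f_ n x) _ (C * C') t) => // [n x|x].
- have C0 : 0 <= C by apply: le_trans (sC x).
  rewrite normrM -mulrA.
  by apply: ler_pM.
- by apply: cvgM; [exact: cvg_cst|exact: f_f].
Qed.

Let multiplier_eq f g : f =1 g -> multiplier f -> multiplier g.
Proof. by move=> /funext ->. Qed.

Lemma multiplier_cst a : multiplier (fun=> a).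
Proof.
split => [|f ef]; last exact: expcl_scale.
by exists `|a|.
Qed.

Lemma multiplierD f g : multiplier f -> multiplier g ->
  multiplier (fun x => f x + g x).
Proof.
move=> [[C fC] mf] [[C' gC] mg]; split.
  by exists (C + C') => x; rewrite (le_trans (ler_normD _ _))// lerD.
move=> h eh; apply: (@expcl_eq (fun x => 1 * (f x * h x) + g x * h x)).
  by move=> x; ring.
by apply: expcl_lin; [exact: mf|exact: mg].
Qed.

Lemma multiplierM f g : multiplier f -> multiplier g ->
  multiplier (fun x => f x * g x).
Proof.
move=> [[C fC] mf] [[C' gC] mg]; split.
  by exists (C * C') => x; rewrite normrM ler_pM.
move=> h eh; apply: (@expcl_eq (fun x => f x * (g x * h x))).
  by move=> x; ring.
exact/mf/mg.
Qed.

Lemma multiplier1B f : multiplier f -> multiplier (fun x => 1 - f x).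
Proof.
move=> mf; apply: (@multiplier_eq (fun x => 1 + (-1) * f x)).
  by move=> x; rewrite mulN1r.
apply: multiplierD; first exact: multiplier_cst.
apply: multiplierM => //; exact: multiplier_cst.
Qed.

Lemma multiplierX f n : multiplier f -> multiplier (fun x => f x ^+ n).
Proof.
move=> mf; elim: n => [|n IHn]; first exact: (multiplier_cst 1).
apply: (@multiplier_eq (fun x => f x * f x ^+ n)).
  by move=> x; rewrite exprS.
exact: multiplierM.
Qed.

Lemma multiplier_lim (f_ : nat -> T -> R) f C :
  (forall n, multiplier (f_ n)) -> (forall n x, `|f_ n x| <= C) ->
  (forall x, f_ n x @[n --> \oo] --> f x) -> multiplier f.
Proof.
move=> mf_ f_C f_f; apply: multiplierP.
  exists C => x; have h : `|f_ n x| @[n --> \oo] --> `|f x| by exact: cvg_norm.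
  by apply: (cvgr_to_le h); exact: nearW.
move=> v; apply: (@expcl_lim (fun n x => f_ n x * expR (Y v x)) _ C [:: v]).
- by move=> n; apply: (mf_ n).2; exact: expcl_exp.
- move=> n x; rewrite /dominator big_seq1 normrM [`|expR _|]ger0_norm ?expR_ge0//.
  by rewrite ler_wpM2r ?expR_ge0.
- by move=> x; apply: cvgM; [exact: f_f|exact: cvg_cst].
Qed.

(** Partial sums of the power series are polynomials in [Y v], covered by [expcl_pow]; times exp (Y
    w) they are dominated by the exponentials at w + v and w - v. *)
Let multiplier_trig (c : R -> nat -> R) (b : nat -> R) (g : R -> R) v :
  (forall y n, c y n = b n * y ^+ n) ->
  (forall y n, `|c y n| <= exp_coeff `|y| n) ->
  (forall y, series (c y) @ \oo --> g y) -> (forall y, `|g y| <= 1) ->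
  multiplier (fun x => g (Y v x)).
Proof.
move=> cE c_le cg g1; apply: multiplierP; first by exists 1.
move=> w; apply: (@expcl_lim (fun n x => series (c (Y v x)) n * expR (Y w x))
  _ 1 [:: w + v; w - v]).
- move=> n; apply: (@expcl_eq (fun x =>
      \sum_(0 <= i < n) b i * (Y v x ^+ i * expR (Y w x)))).
    move=> x; rewrite /series/= mulr_suml; apply: eq_bigr => i _.
    by rewrite cE mulrA.
  by apply: expcl_sum => i; apply: expcl_scale; exact: expcl_pow.
- move=> n x; rewrite /dominator big_cons big_seq1 mul1r.
  rewrite normrM [`|expR _|]ger0_norm ?expR_ge0//.
  rewrite !YD -scaleN1r !YZ mulN1r !expRD -mulrDr mulrC ler_wpM2l ?expR_ge0//.
  apply: le_trans (expR_norm_le _); exact: norm_series_trig_le.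
- by move=> x; apply: cvgM; [exact: cg|exact: cvg_cst].
Qed.

Lemma multiplier_sin v : multiplier (fun x => sin (Y v x)).
Proof.
apply: (multiplier_trig (c := @sin_coeff R)
  (b := fun n => (odd n)%:R * (-1) ^+ n.-1./2 * (n`!%:R)^-1)).
- by move=> y n; rewrite /sin_coeff/= -!mulrA [_ / _]mulrC.
- exact: norm_sin_coeff_le.
- move=> y; rewrite sin.unlock; exact: is_cvg_series_sin_coeff.
- by move=> y; rewrite ler_norml sin_geN1 sin_le1.
Qed.

Lemma multiplier_cos v : multiplier (fun x => cos (Y v x)).
Proof.
apply: (multiplier_trig (c := @cos_coeff R)
  (b := fun n => (~~ odd n)%:R * (-1) ^+ n./2 * (n`!%:R)^-1)).
- by move=> y n; rewrite /cos_coeff/= -!mulrA [_ / _]mulrC.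
- exact: norm_cos_coeff_le.
- move=> y; rewrite cos.unlock; exact: is_cvg_series_cos_coeff.
- by move=> y; rewrite ler_norml cos_geN1 cos_le1.
Qed.

Let multiplier_sin_lt0 v c :
  multiplier (fun x => (sin (Y v x - c) < 0)%R%:R).
Proof.
(* The affine map brings the sine into [0, 1] and its threshold 0 to 1/2, the jump of
   [cvg_step_polynomial]. *)
pose p x := (1 + sin (Y v x - c)) / 2.
have p01 x : 0 <= p x <= 1.
  have := sin_geN1 (Y v x - c); have := sin_le1 (Y v x - c); rewrite /p; lra.
have mp : multiplier p.
  apply: (@multiplier_eq (fun x => (1 + (cos c * sin (Y v x) +
    (- sin c) * cos (Y v x))) * (1 / 2))).
    by move=> x; rewrite /p sinB; ring.
  apply: multiplierM; last exact: multiplier_cst.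
  apply: multiplierD; first exact: multiplier_cst.
  apply: multiplierD; apply: multiplierM; try exact: multiplier_cst.
    exact: multiplier_sin.
  exact: multiplier_cos.
apply: (@multiplier_lim (fun n x => (1 - p x ^+ n) ^+ (n * 2 ^ n)) _ 1).
- by move=> n; apply: multiplierX; apply: multiplier1B; exact: multiplierX.
- move=> n x; have /andP[p0 p1] := p01 x.
  have h : 0 <= 1 - p x ^+ n <= 1.
    by rewrite subr_ge0 exprn_ile1//= lerBlDr lerDl exprn_ge0.
  case/andP: h => h0 h1.
  by rewrite ger0_norm ?exprn_ge0// exprn_ile1.
- move=> x; have := cvg_step_polynomial (p01 x).
  suff -> : (p x < 1 / 2) = (sin (Y v x - c) < 0) by [].
  by rewrite /p; apply/idP/idP => h; lra.
Qed.

Lemma multiplier_lt v c : multiplier (fun x => (Y v x < c)%R%:R).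
Proof.
apply: (@multiplier_lim
  (fun k x => (sin ((Y v x - c) / k.+1%:R) < 0)%R%:R) _ 1).
- move=> k; apply: (@multiplier_eq (fun x =>
    (sin (Y (k.+1%:R^-1 *: v) x - c / k.+1%:R) < 0)%R%:R)).
    by move=> x; rewrite YZ mulrBl [_^-1 * _]mulrC.
  exact: multiplier_sin_lt0.
- by move=> k x; case: (_ < _); rewrite ?normr1 ?normr0.
- by move=> x; rewrite -subr_lt0; exact: cvg_sin_sign.
Qed.

(** Complements come from 1 - f and finite intersections from products, so no pi-lambda argument is
    involved. A countable union is the complement of a pointwise limit of finite products. *)
Lemma sigma_algebra_multiplier :
  sigma_algebra setT [set A : set T | multiplier \1_A].
Proof.
have mC A : multiplier \1_A -> multiplier \1_(~` A).
  move=> /multiplier1B; apply: multiplier_eq => x.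
  by rewrite /= !indicE in_setC; case: (x \in A); rewrite ?subrr ?subr0.
split => [|A|A mA]/=.
- by rewrite indic0; exact: multiplier_cst.
- by rewrite setTD; exact: mC.
rewrite -[X in \1_X]setCK; apply: (mC); rewrite setC_bigcup.
pose f n x : R := \prod_(0 <= i < n) \1_(~` A i) x.
have f01 n x : f n x = (`[< forall i, (i < n)%N -> ~ A i x >])%:R.
  elim: n => [|n IHn]; rewrite /f.
    by rewrite big_geq//; case: asboolP => // -[].
  rewrite big_nat_recr//= -/(f n x) IHn indicE.
  case: asboolP => h; last first.
    rewrite mul0r; case: asboolP => // h'; exfalso; apply: h => i ?.
    exact/h'/ltnW.
  rewrite mul1r; congr (nat_of_bool _)%:R; apply/idP/asboolP.
    rewrite inE => Anx i; rewrite ltnS leq_eqVlt => /orP[/eqP->//|]; exact: h.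
  by move=> h'; rewrite inE; exact: h'.
apply: (@multiplier_lim f _ 1).
- move=> n; elim: n => [|n IHn].
    apply: (multiplier_eq _ (multiplier_cst 1)) => x.
    by rewrite /f big_geq.
  apply: (@multiplier_eq (fun x => f n x * \1_(~` A n) x)).
    by move=> x; rewrite /f big_nat_recr.
  by apply: multiplierM => //; exact/mC/mA.
- by move=> n x; rewrite f01; case: asboolP; rewrite ?normr1 ?normr0.
- move=> x; apply: cvg_near_cst; rewrite indicE.
  have [h|/existsNP[i /contrapT Aix]] := pselect (forall i, ~ A i x).
    near=> n; rewrite f01; case: asboolP => [_|[]]; last by move=> *; exact: h.
    by rewrite mem_set// => i _; exact: h.
  near=> n; rewrite f01; case: asboolP => [h'|_].
    exfalso; apply: (h' i) => //; near: n; exact: nbhs_infty_gt.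
  by rewrite memNset// => /(_ i Logic.I).
Unshelve. all: by end_near. Qed.

Theorem mgf_determines_law A :
  <<s [set B | exists v c, B = [set x | Y v x < c]] >> A ->
  mu A = (\int[nu]_x (L x * \1_A x)%:E)%E.
Proof.
move=> sA.
have mA : multiplier \1_A.
  apply: (smallest_sub sigma_algebra_multiplier _ sA) => _ [v [c ->]] /=.
  apply: (multiplier_eq _ (multiplier_lt v c)) => x.
  by rewrite indicE; congr (nat_of_bool _)%:R; apply/idP/idP; rewrite inE.
(* The constant 1 is the exponential at v = 0; multiplying it by [\1_A] puts the indicator itself in
   [expcl]. *)
have e1 : expcl (fun=> 1).
  by apply: (expcl_eq _ (expcl_exp 0)) => x; rewrite Y0 expR0.
have [mf _ _ E] := expcl_integral (expcl_eq (fun x => mulr1 _) (mA.2 _ e1)).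
rewrite -E integral_indic ?setIT//.
have -> : A = \1_A @^-1` [set (1 : R)].
  apply/seteqP; split => x /=; rewrite indicE.
    by move/mem_set ->.
  by case: (boolP (x \in A)) => [/set_mem//|_] /= /eqP; rewrite eq_sym oner_eq0.
by rewrite -[X in measurable X]setTI; exact: mf.
Qed.

End mgf_determines_law.

(** * Gaussian moments *)

Section normal_mgf.
Context {R : realType}.
Local Notation leb := (@lebesgue_measure R).

(** The general change of variables is phrased with the Radon-Nikodym derivative, which agrees
    almost everywhere with the Gaussian density because both have the same integral over every
    measurable set. *)
Lemma ge0_integral_normal_prob (m s : R) (f : R -> \bar R) :
  measurable_fun setT f -> (forall x, (0 <= f x)%E) ->
  (\int[normal_prob m s]_x f x =
   \int[leb]_x (f x * (normal_pdf m s x)%:E))%E.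
Proof.
move=> mf f0; have dom := normal_prob_dominates m s.
rewrite -(@Radon_Nikodym_SigmaFinite.change_of_variables _ _ _ _ leb dom f)//.
have iRN := Radon_Nikodym_SigmaFinite.f_integrable dom.
have mRN := measurable_int _ iRN.
have mpdf : measurable_fun setT (EFin \o normal_pdf m s).
  by apply/measurable_EFinP; exact: measurable_normal_pdf.
apply: ae_eq_integral => //.
- exact: emeasurable_funM.
- exact: emeasurable_funM.
- apply: ae_eqe_mul2l; apply: integral_ae_eq => // E _ mE.
  by rewrite -Radon_Nikodym_SigmaFinite.f_integral.
Qed.

(** Completing the square: exponential tilting moves the mean by t s^2, and the constant left over
    is the moment generating function. *)
Lemma expR_mul_normal_pdf (m s t x : R) : s != 0 ->
  expR (t * x) * normal_pdf m s x =
  expR (t * m + t ^+ 2 * s ^+ 2 / 2) * normal_pdf (m + t * s ^+ 2) s x.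
Proof.
move=> s0; rewrite !normal_pdfE// mulrCA [RHS]mulrCA; congr (_ * _).
rewrite /normal_fun -!expRD; congr expR; field.
by rewrite s0.
Qed.

Lemma normal_prob_mgf (m s t : R) : s != 0 ->
  (\int[normal_prob m s]_x (expR (t * x))%:E =
   (expR (t * m + t ^+ 2 * s ^+ 2 / 2))%:E)%E.
Proof.
move=> s0; have mexp : measurable_fun setT (fun x : R => expR (t * x)).
  by apply: measurableT_comp => //; exact: measurable_funM.
rewrite ge0_integral_normal_prob; last 2 first.
- exact/measurable_EFinP.
- by move=> x; rewrite lee_fin expR_ge0.
under eq_integral do rewrite -EFinM expR_mul_normal_pdf// EFinM.
rewrite integralZl//; last exact: integrable_normal_pdf.
by rewrite integral_normal_pdf mule1.
Qed.

Lemma normal_law_mgf d (T : measurableType d) (P : probability T R)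
    (f : T -> R) (m s t : R) : measurable_fun setT f ->
  (forall A, measurable A -> P (f @^-1` A) = normal_law m s A) ->
  (\int[P]_x (expR (t * f x))%:E =
   (expR (t * m + t ^+ 2 * s ^+ 2 / 2))%:E)%E.
Proof.
move=> mf fE; have mexp : measurable_fun setT (fun x : R => (expR (t * x))%:E).
  apply/measurable_EFinP.
  by apply: measurableT_comp => //; exact: measurable_funM.
have mf' : measurable_fun setT (f : T -> measurableTypeR R) by exact: mf.
pose F : {RV P >-> measurableTypeR R} :=
  HB.pack (f : T -> measurableTypeR R) (isMeasurableFun.Build _ _ _ _ _ mf').
have <- : (\int[distribution P F]_y (expR (t * y))%:E =
    \int[P]_x (expR (t * f x))%:E)%E.
  by rewrite ge0_integral_distribution// => y; rewrite lee_fin expR_ge0.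
have [s0|s0] := eqVneq s 0; last first.
  rewrite -normal_prob_mgf//; apply: eq_measure_integral => A mA _.
  by rewrite [LHS](fE A mA) /normal_law (negbTE s0).
transitivity (\int[@dirac _ (measurableTypeR R) m R]_y (expR (t * y))%:E)%E.
  apply: eq_measure_integral => A mA _.
  by rewrite [LHS](fE A mA) /normal_law s0 eqxx.
by rewrite integral_dirac// diracT mul1e s0 expr0n mulr0 mul0r addr0.
Qed.

End normal_mgf.

Section gaussian_moments.
Context d (T : measurableType d) (R : realType) (P : probability T R).
Variables (f : T -> R) (v : R).
Hypothesis mf : measurable_fun setT f.
Hypothesis fmgf : forall t,
  (\int[P]_x (expR (t * f x))%:E = (expR (t ^+ 2 * v / 2))%:E)%E.

Let mexp t : measurable_fun setT (fun x => expR (t * f x)).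
Proof. by apply: measurableT_comp => //; exact: measurable_funM. Qed.

Let iexp t : P.-integrable setT (EFin \o (fun x => expR (t * f x))).
Proof.
apply/integrableP; split; first exact/measurable_EFinP.
under eq_integral do rewrite /= ger0_norm ?expR_ge0//.
by rewrite fmgf ltry.
Qed.

(** Obtained from |y|^n <= n! exp |y| and exp |y| <= exp y + exp (-y), with y = [f x]. *)
Let dom n t x := n`!%:R * (expR ((t + 1) * f x) + expR ((t - 1) * f x)).

Let dom_ge0 n t x : 0 <= dom n t x.
Proof. by rewrite mulr_ge0// addr_ge0// expR_ge0. Qed.

Let idom n t : P.-integrable setT (EFin \o dom n t).
Proof.
have -> : EFin \o dom n t = (fun x => n`!%:R%:E *
    ((expR ((t + 1) * f x))%:E + (expR ((t - 1) * f x))%:E))%E.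
  by apply/funext => x; rewrite /dom /= EFinM EFinD.
apply: integrableZl => //; apply: integrableD => //; exact: iexp.
Qed.

Let pow_exp_le n t x : `|f x ^+ n * expR (t * f x)| <= dom n t x.
Proof.
rewrite normrM normrX [`|expR _|]ger0_norm ?expR_ge0//.
apply: (@le_trans _ _ (n`!%:R * expR `|f x| * expR (t * f x))).
  by rewrite ler_wpM2r ?expR_ge0// exprn_le_expR.
rewrite /dom -mulrA ler_wpM2l// -expRD mulrDl mulrBl mul1r.
by have [h|h] := ger0P (f x); rewrite addrC ?lerDl ?lerDr expR_ge0.
Qed.

Let mpow n t : measurable_fun setT (fun x => f x ^+ n * expR (t * f x)).
Proof. by apply: measurable_funM => //; exact: measurable_funX. Qed.

Let ipow n t : P.-integrable setT (EFin \o (fun x => f x ^+ n * expR (t * f x))).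
Proof.
apply: le_integrable (idom n t) => //; first exact/measurable_EFinP.
by move=> x _ /=; rewrite lee_fin [leRHS]ger0_norm.
Qed.

Let M n t := \int[P]_x (f x ^+ n * expR (t * f x)).

Let derive_pow n x (t : R) :
  is_derive t (1 : R) (fun t : R => f x ^+ n * expR (t * f x)) (f x ^+ n.+1 * expR (t * f x)).
Proof.
have h0 : is_derive t (1 : R) (fun t : R => f x * t) (f x).
  by have := is_deriveZ (f x) (is_derive_id t (1 : R)); rewrite /GRing.scale/= mulr1.
have := is_deriveZ (f x ^+ n) (is_derive1_comp (is_derive_expR _) h0).
rewrite /GRing.scale/= [f x * t]mulrC [expR _ * f x]mulrC mulrA -exprSr.
by congr is_derive; apply/funext => s /=; rewrite mulrC.
Qed.

Let M_derive n (t : R) : derive1 (M n) t = M n.+1 t.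
Proof.
have dE s y : partial1of2 (fun (t : R) x => f x ^+ n * expR (t * f x)) s y =
    f y ^+ n.+1 * expR (s * f y).
  by rewrite partial1of2E; have /(@derive_val _ _ _ _ _ _ _) := derive_pow n y s.
(* A bound uniform over s in ]t-1, t+1[: the exponentials with rates s+1 and s-1 are below those of
   [dom (t + 1)] where f >= 0, and below those of [dom (t - 1)] where f < 0. *)
pose G x := dom n.+1 (t + 1) x + dom n.+1 t x + dom n.+1 (t - 1) x.
have It : `]t - 1, t + 1[%classic t by rewrite /= in_itv/=; lra.
have i1 s : `]t - 1, t + 1[%classic s ->
    P.-integrable setT (EFin \o (fun x => f x ^+ n * expR (s * f x))).
  by move=> _; exact: ipow.
have d1 s y : `]t - 1, t + 1[%classic s -> setT y ->
    derivable (fun s : R => f y ^+ n * expR (s * f y)) s 1.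
  by move=> _ _; have [] := derive_pow n y s.
have G0 y : 0 <= G y by rewrite !addr_ge0.
have iG : P.-integrable setT (EFin \o G).
  have -> : EFin \o G = (fun x => (dom n.+1 (t + 1) x)%:E +
      (dom n.+1 t x)%:E + (dom n.+1 (t - 1) x)%:E)%E.
    by apply/funext => x; rewrite /G /= !EFinD.
  by apply: integrableD => //; [apply: integrableD => //|]; exact: idom.
have GB s y : `]t - 1, t + 1[%classic s -> setT y ->
    `|partial1of2 (fun (t : R) x => f x ^+ n * expR (t * f x)) s y| <= G y.
  rewrite /= in_itv/= => /andP[s1 s2] _; rewrite dE.
  apply: (le_trans (pow_exp_le _ _ _)).
  rewrite /G /dom -!mulrDr ler_wpM2l//.
  have e0 z : 0 <= expR (z * f y) by exact: expR_ge0.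
  have [y0|y0] := leP 0 (f y).
    have h1 : expR ((s + 1) * f y) <= expR ((t + 1 + 1) * f y).
      by rewrite ler_expR ler_wpM2r//; lra.
    have h2 : expR ((s - 1) * f y) <= expR ((t + 1 - 1) * f y).
      by rewrite ler_expR ler_wpM2r//; lra.
    have := e0 (t + 1); have := e0 (t - 1); have := e0 (t - 1 + 1).
    have := e0 (t - 1 - 1); lra.
  have h1 : expR ((s + 1) * f y) <= expR ((t - 1 + 1) * f y).
    by rewrite ler_expR ler_wnM2r ?ltW//; lra.
  have h2 : expR ((s - 1) * f y) <= expR ((t - 1 - 1) * f y).
    by rewrite ler_expR ler_wnM2r ?ltW//; lra.
  have := e0 (t + 1); have := e0 (t - 1); have := e0 (t + 1 + 1).
  have := e0 (t + 1 - 1); lra.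
rewrite (differentiation_under_integral measurableT It i1 d1 G0 iG GB).
by apply: eq_Rintegral => x _; rewrite dE.
Qed.

(* Hermite polynomials up to scaling: [M n t = (H n).[t] * expR (t ^+ 2 * v / 2)]. *)
Let H n := iter n (fun p : {poly R} => p^`() + v *: ('X * p)) 1.

Let ME n t : M n t = (H n).[t] * expR (t ^+ 2 * v / 2).
Proof.
elim: n t => [|n IHn] t.
  rewrite /M /Rintegral; under eq_integral do rewrite expr0 mul1r.
  by rewrite fmgf /= hornerC mul1r.
rewrite -M_derive.
have -> : M n = horner (H n) * (expR \o horner ((v / 2) *: 'X^2)).
  apply/funext => s; rewrite IHn/= !fctE /= hornerZ hornerXn.
  by congr (_ * expR _); lra.
have h : is_derive t (1 : R) (expR \o horner ((v / 2) *: 'X^2))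
    (expR (((v / 2) *: 'X^2).[t]) * ((v / 2) *: 'X^2)^`().[t]).
  exact: is_derive1_comp (is_derive_expR _) (is_derive_poly _ _).
rewrite derivZ derivXn !hornerZ hornerMn !hornerXn/= in h.
have := @is_deriveM _ _ _ _ t 1 _ _ (is_derive_poly (H n) t) h.
move=> /(@derive_val _ _ _ _ _ _ _); rewrite derive1E => ->.
rewrite /= /GRing.scale/= !hornerE /=.
set e := expR _; set e' := expR _; have -> : e' = e.
  by rewrite /e /e'; congr expR; lra.
by field.
Qed.

Lemma gaussian_integrable_pow n : P.-integrable setT (EFin \o (fun x => f x ^+ n)).
Proof.
have := ipow n 0; congr (_ .-integrable _ _).
by apply/funext => x /=; rewrite mul0r expR0 mulr1.
Qed.

Lemma gaussian_moments :
  [/\ (\int[P]_x (f x)%:E = 0)%E, (\int[P]_x (f x ^+ 2)%:E = v%:E)%E &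
      (\int[P]_x (f x ^+ 4)%:E = (3 * v ^+ 2)%:E)%E].
Proof.
have mE n : (\int[P]_x (f x ^+ n)%:E = ((H n).[0])%:E)%E.
  have := ME n 0; rewrite expr0n/= !mul0r expR0 mulr1 => <-.
  rewrite /M /Rintegral.
  under [in RHS]eq_integral do rewrite mul0r expR0 mulr1.
  by rewrite fineK//; exact: integrable_fin_num (gaussian_integrable_pow n).
split.
- under eq_integral do rewrite -[f _]expr1.
  by rewrite mE /H /= !poly.derivE !hornerE /=; congr EFin; ring.
- by rewrite mE /H /= !poly.derivE !hornerE /=; congr EFin; ring.
- by rewrite mE /H /= !poly.derivE !hornerE /=; congr EFin; ring.
Qed.

End gaussian_moments.

(** * Gaussian measures on a Hilbert space *)

Section inner_product.
Context {R : realType} {H : completeNormedModType R}.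
Variable ip : {dot H for idfun}.
Hypothesis hip : inner_product_norm ip.
Implicit Types (x y z : H) (a : R).

Lemma ipC x y : ip x y = ip y x.
Proof. by rewrite hermC expr0 mul1r. Qed.

Lemma ipDl x y z : ip (x + y) z = ip x z + ip y z.
Proof. exact: linearDl. Qed.

Lemma ipDr x y z : ip z (x + y) = ip z x + ip z y.
Proof. exact: linearDr. Qed.

Lemma ipBl x y z : ip (x - y) z = ip x z - ip y z.
Proof. exact: linearBl. Qed.

Lemma ipBr x y z : ip z (x - y) = ip z x - ip z y.
Proof. exact: linearBr. Qed.

Lemma ipZl a x y : ip (a *: x) y = a * ip x y.
Proof. exact: linearZl_LR. Qed.

Lemma ipZr a x y : ip x (a *: y) = a * ip x y.
Proof. by rewrite ipC ipZl ipC. Qed.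

Lemma ip0l x : ip 0 x = 0. Proof. exact: linear0l. Qed.

Lemma ip_suml (I : Type) (r : seq I) (Q : pred I) (F : I -> H) x :
  ip (\sum_(i <- r | Q i) F i) x = \sum_(i <- r | Q i) ip (F i) x.
Proof.
by apply: (big_morph (ip ^~ x)) => [y z|]; [exact: ipDl|exact: ip0l].
Qed.

Lemma ip_ge0 x : 0 <= ip x x. Proof. by rewrite -hip exprn_ge0. Qed.

Lemma cauchy_schwarz x y : `|ip x y| <= `|x| * `|y|.
Proof.
have [->|y0] := eqVneq y 0.
  by rewrite ipC ip0l normr0 mulr_ge0.
have ny : 0 < `|y| ^+ 2 by rewrite exprn_gt0// normr_gt0.
rewrite -[leRHS]ger0_norm ?mulr_ge0// -ler_sqr ?nnegrE//.
rewrite !real_normK ?num_real// exprMn.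
have := ip_ge0 (x - (ip x y / `|y| ^+ 2) *: y).
rewrite ipBl !ipBr !ipZl !ipZr -!hip [ip y x]ipC.
set n := `|y| ^+ 2 in ny *; set c := ip x y.
have -> : `|x| ^+ 2 - c / n * c - (c / n * c - c / n * (c / n * n)) =
   (`|x| ^+ 2 * n - c ^+ 2) / n.
  by field; rewrite gt_eqF.
by rewrite pmulr_lge0 ?invr_gt0// subr_ge0.
Qed.

Lemma continuous_ip h : continuous (fun x : H => ip x h).
Proof.
move=> x; apply/cvgrPdist_lt => e e0; near=> y.
rewrite -ipBl; apply: (le_lt_trans (cauchy_schwarz _ _)).
have h1 : 0 < `|h| + 1 by rewrite ltr_wpDl.
apply: (@le_lt_trans _ _ (`|x - y| * (`|h| + 1))).
  by rewrite ler_wpM2l// lerDl.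
rewrite -ltr_pdivlMr//; near: y.
have := @cvg_id _ (nbhs x) => /cvgrPdist_lt; apply; exact: divr_gt0.
Unshelve. all: by end_near. Qed.

Lemma measurable_continuous (f : H -> R) : continuous f ->
  measurable_fun setT (f : borel H -> R).
Proof.
move=> cf; apply: (measurability _ (RGenOpens.measurableE R)) => //.
move=> _ [_ [a [b ->] <-]]; rewrite setTI; apply: sub_sigma_algebra.
by move/continuousP: cf; apply; exact: interval_open.
Qed.

Lemma measurable_ip h : measurable_fun setT (fun x : borel H => ip x h).
Proof. by apply: measurable_continuous; exact: continuous_ip. Qed.

Section gaussian_functionals.
Variables (P : probability (borel H) R) (m : H) (K : {linear H -> H}).
Hypothesis gP : gaussian ip P m K.

(** [gaussian_measure] leaves the parameters of each one-dimensional law unspecified; the moments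
    computed from that law identify them with the given mean and covariance. *)
Let gaussian_functional h : exists2 m0 : R, exists2 v : R,
  (forall t, (\int[P]_x (expR (t * (ip x h - m0)))%:E =
    (expR (t ^+ 2 * v / 2))%:E)%E) & ip (K h) h = v & ip m h = m0.
Proof.
have [gPm gPe gPc] := gP; have [m0 [s hs]] := gPm h.
have mh := measurable_ip h.
have mhc : measurable_fun setT (fun x : borel H => ip x h - m0).
  exact: measurable_funB.
have mgf t : (\int[P]_x (expR (t * (ip x h - m0)))%:E =
    (expR (t ^+ 2 * s ^+ 2 / 2))%:E)%E.
  under eq_integral.
    move=> x _; rewrite mulrBr addrC expRD EFinM; over.
  rewrite ge0_integralZl//; last first.
    apply/measurable_EFinP; apply: measurableT_comp => //.
    exact: measurable_funM.
  rewrite (normal_law_mgf _ mh hs) -EFinM -expRD; congr (expR _)%:E; ring.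
have [M1 M2 _] := gaussian_moments mhc mgf.
have i1 := gaussian_integrable_pow mhc mgf 1.
have i0 : P.-integrable setT (EFin \o (fun=> m0)).
  exact: finite_measure_integrable_cst.
have E : ('E_P[fun x : H => ip x h] = m0%:E)%E.
  rewrite unlock.
  rewrite (_ : integral _ _ _ =
      \int[P]_x ((ip x h - m0)%:E + m0%:E))%E; last first.
    by apply: eq_integral => x _; rewrite -EFinD subrK.
  rewrite integralD//= M1 add0e integral_cst//=.
  by rewrite probability_setT mule1.
have Em : ip m h = m0 by have := gPe h; rewrite E => -[].
exists m0 => //; exists (s ^+ 2) => //.
have := gPc h h; rewrite unlock E /= unlock => c.
apply/eqP; rewrite -eqe -c -M2; apply/eqP; apply: eq_integral => x _.
by rewrite /= !fctE/= expr2.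
Qed.

Lemma measurable_ip_centered h :
  measurable_fun setT (fun x : borel H => ip x h - ip m h).
Proof. by apply: measurable_funB => //; exact: measurable_ip. Qed.

Lemma gaussian_mgf h t : (\int[P]_x (expR (t * (ip x h - ip m h)))%:E =
  (expR (t ^+ 2 * ip (K h) h / 2))%:E)%E.
Proof. by have [m0 [v hv ->] ->] := gaussian_functional h. Qed.

Lemma gaussian_expR h : (\int[P]_x (expR (ip x h))%:E =
  (expR (ip m h + ip (K h) h / 2))%:E)%E.
Proof.
have := gaussian_mgf h 1; rewrite expr1n mul1r.
under eq_integral => x _ do rewrite mul1r addrC expRD EFinM.
rewrite ge0_integralZl//; last first.
  apply/measurable_EFinP; apply: measurableT_comp => //; exact: measurable_ip.
move=> /(congr1 (fun c : \bar R => (expR (ip m h))%:E * c)%E).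
by rewrite muleA -!EFinM -!expRD subrr expR0 mul1e => ->.
Qed.

Lemma integrable_gaussian_expR h :
  P.-integrable setT (EFin \o (fun x : borel H => expR (ip x h))).
Proof.
apply/integrableP; split.
  apply/measurable_EFinP; apply: measurableT_comp => //; exact: measurable_ip.
under eq_integral do rewrite /= ger0_norm ?expR_ge0//.
by rewrite gaussian_expR ltry.
Qed.

End gaussian_functionals.
End inner_product.

(** * Approximation by cylinder events *)

Section algebra_approximation.
Context d (T : measurableType d) (R : realType).
Variables (mu : {measure set T -> \bar R}) (D : set (set T)).
Hypothesis muT : (mu setT < +oo)%E.
Hypothesis mD : D `<=` measurable.
Hypotheses (D0 : D set0) (DC : setC_closed D) (DU : setU_closed D).

Let symdiff (A B : set T) := (A `\` B) `|` (B `\` A).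

Let msymdiff A B : measurable A -> measurable B -> measurable (symdiff A B).
Proof. by move=> mA mB; apply: measurableU; apply: measurableD. Qed.

(** The approximable sets form a sigma-algebra: symmetric differences are unchanged by complements
    and subadditive under unions, and finiteness of [mu] lets a finite union replace a countable one
    up to e/2. *)
Lemma algebra_approximation A : <<s D >> A -> forall e : R, 0 < e ->
  exists2 B, D B & (mu ((A `\` B) `|` (B `\` A)) <= e%:E)%E.
Proof.
pose S := [set A : set T | measurable A /\ forall e : R, 0 < e ->
  exists2 B, D B & (mu (symdiff A B) <= e%:E)%E].
suff sS : sigma_algebra setT S.
  move=> sA; suff [] : S A by [].
  apply: (smallest_sub sS _ sA) => B DB; split; first exact: mD.
  move=> e e0; exists B => //.
  by rewrite /symdiff setDv setU0 measure0 lee_fin ltW.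
have S0 : S set0.
  split=> // e e0; exists set0 => //.
  by rewrite /symdiff setDv setU0 measure0 lee_fin ltW.
have SU E F : S E -> S F -> S (E `|` F).
  move=> [mE SE] [mF SF]; split; first exact: measurableU.
  move=> e e0; have e2 : 0 < e / 2 by rewrite divr_gt0.
  have [B DB hB] := SE _ e2; have [C DCC hC] := SF _ e2.
  exists (B `|` C); first exact: DU.
  have mB := mD DB; have mC := mD DCC.
  apply: (@le_trans _ _ (mu (symdiff E B `|` symdiff F C))).
    apply: le_measure; rewrite ?inE.
    - by apply: msymdiff; apply: measurableU.
    - by apply: measurableU; apply: msymdiff.
    - move=> x [[[Ex|Fx] /not_orP[nB nC]]|[[Bx|Cx] /not_orP[nE nF]]].
      + by left; left.
      + by right; left.
      + by left; right.
      + by right; right.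
  apply: le_trans (measureU2 _ _ _) _; [exact: msymdiff|exact: msymdiff|].
  by rewrite [e in leRHS]splitr EFinD leeD.
split => //.
- move=> E [mE SE]; rewrite setTD; split; first exact: measurableC.
  move=> e e0; have [B DB hB] := SE _ e0; exists (~` B); first exact: DC.
  rewrite (_ : symdiff _ _ = symdiff E B)// /symdiff !setDE !setCK.
  by rewrite setUC [B `&` _]setIC [~` B `&` _]setIC.
- move=> F SF; have mF n : measurable (F n) by have [] := SF n.
  have mUF : measurable (\bigcup_n F n) by exact: bigcupT_measurable.
  split => // e e0; have e2 : 0 < e / 2 by rewrite divr_gt0.
  pose G n := \big[setU/set0]_(i < n) F i.
  have SG n : S (G n).
    by elim: n => [|n IHn]; rewrite /G ?big_ord0// big_ord_recr /=; exact: SU.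
  have mG n : measurable (G n) by have [] := SG n.
  have GE n : G n = \bigcup_(i < n) F i by rewrite /G bigcup_mkord.
  pose E n := (\bigcup_n F n) `\` G n.
  have mE n : measurable (E n) by exact: measurableD.
  have E0 : \bigcap_n E n = set0.
    apply/seteqP; split => // x Ex.
    have [[k _ Fkx] _] := Ex 0%N Logic.I.
    have [_] := Ex k.+1 Logic.I; rewrite GE; apply; exists k => //=.
  have cE : mu \o E @ \oo --> mu (\bigcap_n E n).
    apply: nonincreasing_cvg_mu => //.
    - apply: le_lt_trans muT; apply: le_measure; rewrite ?inE//.
    - by rewrite E0.
    - move=> a b ab; apply/subsetPset; apply: setDS; rewrite !GE.
      by apply: bigcup_subset => i /= ia; exact: leq_trans ab.
  rewrite E0 measure0 in cE.
  have [n hn] : exists n, (mu (E n) <= (e / 2)%:E)%E.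
    have [N _ hN] : \forall n \near \oo, ((mu \o E) n < (e / 2)%:E)%E.
      have /cE : nbhs (0 : \bar R)%E [set y | y < (e / 2)%:E]%E.
        by apply: open_ereal_lt'; rewrite lte_fin.
      by [].
    by exists N; apply: ltW; exact: hN N (leqnn N).
  have [B DB hB] := (SG n).2 _ e2; exists B => //; have mB := mD DB.
  apply: (@le_trans _ _ (mu (E n `|` symdiff (G n) B))).
    apply: le_measure; rewrite ?inE.
    - exact: msymdiff.
    - by apply: measurableU => //; exact: msymdiff.
    - move=> x [[Fx nB]|[Bx nF]]; have [Gx|nGx] := pselect (G n x).
      + by right; left.
      + by left.
      + by exfalso; apply: nF; move: Gx; rewrite GE => -[k _ ?]; exists k.
      + by right; right.
  apply: le_trans (measureU2 _ _ _) _ => //; first exact: msymdiff.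
  by rewrite [e in leRHS]splitr EFinD leeD.
Qed.

End algebra_approximation.

(** * Borel sets are generated by coordinate half-spaces *)

Section coordinate_sigma_algebra.
Context {R : realType} {H : completeNormedModType R}.
Variable ip : {dot H for idfun}.
Hypothesis hip : inner_product_norm ip.
Variable gamma : nat -> H.
Hypothesis hgamma : orthonormal_basis ip gamma.

Lemma norm_basis i : `|gamma i| = 1.
Proof.
have [h _] := hgamma; apply/eqP; rewrite -[_ == _](@eqrXn2 _ 2)//.
by rewrite hip h eqxx expr1n.
Qed.

(** The basis expansion of x is fed to the continuous functional [ip ^~ x]. This is what makes balls
    measurable for the coordinates. *)
Lemma parseval x : (\sum_(i < n) ip x (gamma i) ^+ 2) @[n --> \oo] --> `|x| ^+ 2.
Proof.
have [_ /(_ x) h] := hgamma.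
have -> : (fun n => \sum_(i < n) ip x (gamma i) ^+ 2) =
    (fun n => ip (series (fun j => ip x (gamma j) *: gamma j) n) x).
  apply/funext => n; rewrite /series/= ip_suml big_mkord.
  by apply: eq_bigr => i _; rewrite ipZl expr2 [ip (gamma i) x]ipC.
by rewrite hip; exact: (cvg_comp _ _ h (@continuous_ip _ _ _ hip x x)).
Qed.

Definition coord_halfspaces := [set B : set H | exists i c,
  B = [set x | ip x (gamma i) < c]].

Let mcoord i :
  measurable_fun setT (fun x : g_sigma_algebraType coord_halfspaces =>
    ip (x : H) (gamma i)).
Proof.
apply: (measurability _ (RGenInftyO.measurableE R)) => //.
move=> _ [_ [c ->] <-]; rewrite setTI; apply: sub_sigma_algebra.
exists i, c; apply/seteqP; split => x /=; by rewrite in_itv.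
Qed.

Let mball (a : H) r :
  @measurable _ (g_sigma_algebraType coord_halfspaces) [set x : H | `|x - a| < r].
Proof.
have [r0|r0] := leP r 0.
  rewrite (_ : [set _ | _] = set0)//; apply/seteqP; split => // x /=.
  by move=> /lt_le_trans /(_ r0); rewrite normr_lt0.
have mf : measurable_fun setT
    (fun x : g_sigma_algebraType coord_halfspaces => `|(x : H) - a| ^+ 2).
  apply: (@measurable_fun_cvg _ (g_sigma_algebraType coord_halfspaces) R setT
    (fun n x => \sum_(i < n) (ip (x : H) (gamma i) - ip a (gamma i)) ^+ 2)).
    move=> n; apply: measurable_sum => i; apply: measurable_funX.
    by apply: measurable_funB => //; exact: mcoord.
  move=> x _; have := @parseval ((x : H) - a).
  by under eq_fun do under eq_bigr do rewrite ipBl.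
have := mf measurableT `]-oo, r ^+ 2[%classic (measurable_itv _).
rewrite setTI; congr measurable; apply/seteqP; split => x /=; rewrite in_itv/=.
  by rewrite ltr_sqr ?nnegrE// ltW.
by move=> h; rewrite ltr_sqr ?nnegrE// ltW.
Qed.

Let rat_comb (s : seq rat) : H :=
  \sum_(i < size s) ratr (nth 0 s i) *: gamma i.

Let rat_comb_dense (x : H) (e : R) : 0 < e -> exists s, `|x - rat_comb s| < e.
Proof.
move=> e0; have e2 : 0 < e / 2 by rewrite divr_gt0.
have [_ /(_ x) /cvgrPdist_lt /(_ _ e2) [n _ /(_ n (leqnn n)) hn]] := hgamma.
have n1 : (0 : R) < n.+1%:R by [].
have dn : 0 < e / 2 / n.+1%:R by rewrite divr_gt0.
(* Error budget: e/2 for the truncation and e/2 shared by n coefficients; n + 1 keeps the divisor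
   nonzero when n = 0. *)
have hr i : exists q : rat, `|ip x (gamma i) - ratr q| < e / 2 / n.+1%:R.
  have /rat_in_itvoo[q] : ip x (gamma i) < ip x (gamma i) + e / 2 / n.+1%:R.
    by rewrite ltrDl.
  rewrite in_itv/= => /andP[q1 q2]; exists q.
  by rewrite ltr0_norm ?subr_lt0// opprB ltrBlDl.
have [q hq] := choice hr.
exists (mkseq q n); rewrite /rat_comb size_mkseq.
pose S := series (fun j => ip x (gamma j) *: gamma j) n.
rewrite -(subrK S x) -addrA; apply: (le_lt_trans (ler_normD _ _)).
rewrite [ltRHS]splitr; apply: ltr_leD => //.
rewrite /S /series/= big_mkord -sumrB.
apply: (le_trans (ler_norm_sum _ _ _)).
apply: (@le_trans _ _ (\sum_(i < n) (e / 2 / n.+1%:R))).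
  apply: ler_sum => i _; rewrite nth_mkseq// -scalerBl normrZ norm_basis mulr1.
  exact/ltW/hq.
rewrite sumr_const card_ord -[_ *+ n]mulr_natr -mulrA ler_piMr ?ltW//.
by rewrite mulrC ltr_pdivrMr// mul1r ltr_nat.
Qed.

(** An open set is the union of the balls it contains with a centre [rat_comb s] and radius 1/(k+1),
    a countable family. Radius below e/2 keeps such a ball around x inside the e-ball of x. *)
Lemma borel_coord (A : set (borel H)) : measurable A -> <<s coord_halfspaces >> A.
Proof.
apply: smallest_sub; first exact: smallest_sigma_algebra.
move=> U oU.
pose V (p : seq rat * nat) := if `[< [set x : H |
  `|x - rat_comb p.1| < p.2.+1%:R^-1] `<=` U >] then
  [set x : H | `|x - rat_comb p.1| < p.2.+1%:R^-1] else set0.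
have -> : U = \bigcup_p V p.
  apply/seteqP; split => x; last first.
    by move=> [p _]; rewrite /V; case: asboolP => // h; exact: h.
  move=> Ux; have := open_nbhs_nbhs (conj oU Ux) => /nbhs_ballP[e /= e0 be].
  have [k hk] : exists k, k.+1%:R^-1 < e / 2.
    have /cvgrPdist_lt /(_ (e / 2)) := @cvg_harmonic R.
    rewrite divr_gt0// => /(_ isT) [k _ /(_ k (leqnn k))].
    rewrite sub0r normrN ger0_norm ?invr_ge0//; by exists k.
  have [s hs] := rat_comb_dense x (e := k.+1%:R^-1) ltac:(by rewrite invr_gt0).
  exists (s, k) => //; rewrite /V; case: asboolP => [//|[]] y /= hy.
  apply: be; rewrite -ball_normE /=.
  rewrite -(subrK (rat_comb s) x) -addrA; apply: (le_lt_trans (ler_normD _ _)).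
  rewrite [e]splitr ltrD//; first exact: lt_trans hk.
  by rewrite distrC; exact: lt_trans hk.
apply: (@countable_bigcupT_measurable _ (g_sigma_algebraType coord_halfspaces)).
  exact: countableP.
move=> p; rewrite /V; case: ifP => _; last exact: measurable0.
exact: mball.
Qed.

End coordinate_sigma_algebra.

(** * The dichotomy *)

Section common_covariance_dichotomy.
Context {R : realType} {H : completeNormedModType R}.
Variable ip : {dot H for idfun}.
Hypothesis hip : inner_product_norm ip.
Variables (K : {linear H -> H}) (gamma : nat -> H) (lam : nat -> R).
Hypothesis hK : self_adjoint ip K.
Hypothesis hgamma : orthonormal_basis ip gamma.
Hypothesis hlam : forall j, K (gamma j) = lam j *: gamma j.
Hypothesis lam_gt0 : forall j, 0 < lam j.
Variables (m : 'I_2 -> H) (P : 'I_2 -> probability (borel H) R).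
Hypothesis hP : forall l, gaussian ip (P l) (m l) K.

Local Notation nu := (nu ip gamma m).
Local Notation nu_std := (nu_std ip gamma lam m).

Local Notation P0 := (P 0%R).
Local Notation P1 := (P 1%R).
Let S q := \sum_(j < q) nu_std j ^+ 2.
(** [K (u q)] is the projection of [m 1 - m 0] on the first q basis vectors, so [ip x (u q)] is the
    linear part of the log-likelihood ratio. Its variance is [S q] under both measures, and its
    means differ by [S q]. *)
Let u q := \sum_(j < q) (nu j / lam j) *: gamma j.

Let ip_u q j : (j < q)%N -> ip (u q) (gamma j) = nu j / lam j.
Proof.
move=> jq; rewrite /u ip_suml (bigD1 (Ordinal jq))//= big1 ?addr0.
  by rewrite ipZl hgamma.1 eqxx mulr1.
move=> i ij; rewrite ipZl hgamma.1.
case: eqP => [e|_]; last by rewrite mulr0.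
by move: ij; rewrite -val_eqE /= e eqxx.
Qed.

Let ip_Ku q (c : nat -> R) :
  ip (K (u q)) (\sum_(j < q) c j *: gamma j) =
  ip (m 1 - m 0) (\sum_(j < q) c j *: gamma j).
Proof.
rewrite ![ip _ (\sum_(_ < _) _)]ipC !ip_suml; apply: eq_bigr => j _.
rewrite !ipZl [ip _ (K _)]ipC hK hlam ipZr ip_u// mulrC [lam _ * _]mulrC.
by rewrite divfK ?gt_eqF// [in RHS]ipC mulrC.
Qed.

Let ip_Kuu q : ip (K (u q)) (u q) = S q.
Proof.
rewrite (ip_Ku q (fun j => nu j / lam j)) ipC ip_suml; apply: eq_bigr => j _.
rewrite ipZl [ip (gamma _) _]ipC -/(nu j) /nu_std expr_div_n sqr_sqrtr ?ltW//.
by rewrite mulrAC expr2.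
Qed.

Let ip_mu q : ip (m 1) (u q) = ip (m 0) (u q) + S q.
Proof.
by rewrite -ip_Kuu (ip_Ku q (fun j => nu j / lam j)) ipBl addrC subrK.
Qed.

(* The likelihood ratio of the first [q] coordinates. *)
Let L q (x : borel H) := expR (ip x (u q) - (ip (m 0) (u q) + S q / 2)).

Let L_ge0 q x : 0 <= L q x. Proof. exact: expR_ge0. Qed.

Let mL q : measurable_fun setT (L q).
Proof.
apply: measurableT_comp => //; apply: measurable_funB => //; exact: measurable_ip.
Qed.

(** The r-th moment of the likelihood ratio. It is used with r = 1/2 under [P0] and r = -1/2 under
    [P1] for the tail bounds, and with r = 2 under [P0] for the second moment. *)
Let integral_L_pow l q r :
  (\int[P l]_x (expR (r * (ip x (u q) - (ip (m 0) (u q) + S q / 2))))%:E =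
  (expR (r * (ip (m l) (u q) - (ip (m 0) (u q) + S q / 2)) +
         r ^+ 2 * S q / 2))%:E)%E.
Proof.
under eq_integral => x _.
  rewrite mulrBr addrC expRD EFinM -ipZr; over.
rewrite ge0_integralZl//; last first.
  apply/measurable_EFinP; apply: measurableT_comp => //; exact: measurable_ip.
rewrite (gaussian_expR hip (hP l)) -EFinM -expRD; congr (expR _)%:E.
have -> : K (r *: u q) = r *: K (u q) by rewrite linearZ.
by rewrite !ipZr ipZl ip_Kuu; ring.
Qed.

Let mgt q : measurable [set x | (1 <= L q x)%R].
Proof.
have := @mL q measurableT `[1, +oo[%classic (measurable_itv _).
rewrite setTI; congr measurable; apply/seteqP; split => x /=;
  by rewrite in_itv/= andbT.
Qed.

(** Markov's inequality for the r-th power of [L q], whose log-moment (r^2 - r) S/2 is smallest at r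
    = 1/2. Under [P1] it is (r^2 + r) S/2, whence r = -1/2 in [chernoff1]. *)
Let chernoff0 q : (P0 [set x | (1 <= L q x)%R] <= (expR (- (S q / 8)))%:E)%E.
Proof.
have mA := mgt q.
rewrite -[X in P0 X]setIT -integral_indic//.
have -> : expR (- (S q / 8)) = expR (2^-1 * (ip (m 0) (u q) -
   (ip (m 0) (u q) + S q / 2)) + 2^-1 ^+ 2 * S q / 2).
  by congr expR; field.
rewrite -integral_L_pow; apply: ge0_le_integral => //.
- by apply/measurable_EFinP; apply: measurable_indic.
- apply/measurable_EFinP; apply: measurableT_comp => //.
  by apply: measurable_funM => //; apply: measurable_funB => //;
    exact: measurable_ip.
- move=> x _; rewrite lee_fin indicE; case: (boolP (x \in _)); last first.
    by rewrite expR_ge0.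
  rewrite inE/= /L -[leLHS]expR0 ler_expR => h.
  by rewrite -[leLHS]expR0 ler_expR mulr_ge0.
Qed.

Let chernoff1 q :
  (P1 (~` [set x | (1 <= L q x)%R]) <= (expR (- (S q / 8)))%:E)%E.
Proof.
have mA : measurable (~` [set x | (1 <= L q x)%R]) by apply: measurableC; exact: mgt.
rewrite -[X in P1 X]setIT -integral_indic//.
have -> : expR (- (S q / 8)) = expR (- 2^-1 * (ip (m 1) (u q) -
   (ip (m 0) (u q) + S q / 2)) + (- 2^-1) ^+ 2 * S q / 2).
  by congr expR; rewrite ip_mu; field.
rewrite -integral_L_pow; apply: ge0_le_integral => //.
- by apply/measurable_EFinP; apply: measurable_indic.
- apply/measurable_EFinP; apply: measurableT_comp => //.
  by apply: measurable_funM => //; apply: measurable_funB => //;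
    exact: measurable_ip.
- move=> x _; rewrite lee_fin indicE; case: (boolP (x \in _)); last first.
    by rewrite expR_ge0.
  rewrite inE/= /L -[X in X <= expR _]expR0 ler_expR => /negP; rewrite -ltNge => h.
  rewrite -[leLHS]expR0 ler_expR mulNr oppr_ge0 pmulr_rle0//; exact: ltW.
Qed.

Lemma mutually_singular_of_divergence :
  (\sum_(j < q) nu_std j ^+ 2) @[q --> \oo] --> +oo ->
  mutually_singular P0 P1.
Proof.
move=> Soo.
(* The crude bound exp y >= 1 + y suffices, at the price of asking S >= 8 * 2^(k+1). *)
have hq k : exists q, expR (- (S q / 8)) <= 1 / (2 ^ k.+1)%:R :> R.
  have [q _ /(_ q (leqnn q)) hSq] : \forall q \near \oo, 8 * (2 ^ k.+1)%:R <= S q.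
    by move/cvgryPge : Soo; apply.
  exists q; rewrite expRN mul1r lef_pV2 ?posrE ?expR_gt0 ?ltr0n ?expn_gt0//.
  apply: le_trans (expR_ge1Dx _); rewrite -ler_pdivlMl// in hSq.
  by rewrite (le_trans hSq)// mulrC lerDr.
have [q_ hq_] := choice hq.
pose B k := [set x | (1 <= L (q_ k) x)%R].
have mB k : measurable (B k) by exact: mgt.
exists (lim_sup_set B); split.
- by apply: bigcap_measurable => // n _; apply: bigcup_measurable => k _.
- apply: lim_sup_set_cvg0 => //.
  apply: (@le_lt_trans _ _ 1%:E%E); last by rewrite ltry.
  apply: le_trans (@epsilon_trick0 R 1 xpredT ler01).
  apply: lee_nneseries => // k _.
  by apply: le_trans (chernoff0 _) _; rewrite lee_fin.
- rewrite /lim_sup_set setC_bigcap.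
  have mC n : measurable (~` \bigcup_(k >= n) B k).
    by apply: measurableC; apply: bigcup_measurable => k _.
  apply: measure_negligible; first exact: bigcup_measurable.
  rewrite (_ : \bigcup_(i in _) _ = \bigcup_n ~` \bigcup_(k >= n) B k)//.
  apply: negligible_bigcup => n; apply/negligibleP => //.
  (* The complement of a tail union lies in the complement of every [B k] with k >= n, so its
     probability is below all these bounds, which tend to 0. *)
  have le0 k : (n <= k)%N ->
      (P1 (~` \bigcup_(k >= n) B k) <= (1 / (2 ^ k.+1)%:R)%:E)%E.
    move=> nk; apply: (@le_trans _ _ (P1 (~` B k))).
      apply: le_measure; rewrite ?inE//; first exact: measurableC.
      by apply: subsetC => x Bx; exists k.
    by apply: le_trans (chernoff1 _) _; rewrite lee_fin.
  suff c0 : (1 / (2 ^ k.+1)%:R : R)%:E @[k --> \oo] --> 0%E.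
    apply/eqP; rewrite -measure_le0; apply: (cvge_to_ge c0).
    by near=> k; apply: le0; near: k; exact: nbhs_infty_ge.
  apply/cvg_EFin; first exact: nearW.
  apply: (@squeeze_cvgr _ _ _ _ (cst 0) (fun k => k.+1%:R^-1)).
  + apply: nearW => k /=; rewrite mul1r invr_ge0 ler0n /=.
    rewrite lef_pV2 ?posrE ?ltr0n ?expn_gt0// ler_nat.
    exact/ltnW/ltn_expl.
  + exact: cvg_cst.
  + exact: cvg_harmonic.
Unshelve. all: by end_near. Qed.

(** Composing with this projection gives functionals that are linear in v over all of H yet see only
    the first q coordinates, so [mgf_determines_law] applies with index space H. *)
Let Pq q (v : H) := \sum_(j < q) ip v (gamma j) *: gamma j.

Let PqD q v w : Pq q (v + w) = Pq q v + Pq q w.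
Proof.
by rewrite /Pq -big_split/=; apply: eq_bigr => j _; rewrite ipDl scalerDl.
Qed.

Let PqZ q a v : Pq q (a *: v) = a *: Pq q v.
Proof.
by rewrite /Pq scaler_sumr; apply: eq_bigr => j _; rewrite ipZl scalerA.
Qed.

Let Pq_gamma q i : (i < q)%N -> Pq q (gamma i) = gamma i.
Proof.
move=> iq; rewrite /Pq (bigD1 (Ordinal iq))//= big1 ?addr0.
  by rewrite hgamma.1 eqxx scale1r.
move=> j ji; rewrite hgamma.1; case: eqP => [e|_]; last by rewrite scale0r.
by move: ji; rewrite -val_eqE /= e eqxx.
Qed.

Let cylinder q := [set B : set (borel H) | exists i c, (i < q)%N /\
  B = [set x | ip (x : H) (gamma i) < c]].

Let cameron_martin q A : <<s cylinder q >> A ->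
  P1 A = (\int[P0]_x (L q x * \1_A x)%:E)%E.
Proof.
move=> sA.
have LE v x : L q x * expR (ip x (Pq q v)) =
    expR (- (ip (m 0) (u q) + S q / 2)) * expR (ip x (u q + Pq q v)).
  by rewrite /L -!expRD ipDr; congr expR; ring.
have mexp v : measurable_fun setT (fun x : borel H => expR (ip x v)).
  by apply: measurableT_comp => //; exact: measurable_ip.
apply: (@mgf_determines_law _ (borel H) R P1 P0 (L q) H
  (fun v x => ip x (Pq q v))) => //.
- by move=> v w x; rewrite PqD ipDr.
- by move=> a v x; rewrite PqZ ipZr.
- by move=> v; exact: measurable_ip.
- by move=> v; exact: (integrable_gaussian_expR hip (hP 1%R)).
- move=> v; under eq_fun do rewrite LE.
  rewrite (_ : EFin \o _ = (fun x => (expR (- (ip (m 0) (u q) + S q / 2)))%:E *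
     (expR (ip x (u q + Pq q v)))%:E)%E); last by apply/funext.
  by apply: integrableZl => //; exact: (integrable_gaussian_expR hip (hP 0%R)).
- move=> v; under [in RHS]eq_integral do rewrite LE EFinM.
  rewrite ge0_integralZl//; last exact/measurable_EFinP.
  rewrite !(gaussian_expR hip (hP _)) -EFinM -expRD; congr (expR _)%:E.
  set w := Pq q v.
  (* The cross term between [u q] and w in the quadratic form is exactly the change of mean. *)
  have Kuw : ip (K (u q)) w = ip (m 1) w - ip (m 0) w.
    by rewrite -ipBl; exact: (ip_Ku q (fun j => ip v (gamma j))).
  have -> : K (u q + w) = K (u q) + K w by rewrite linearD.
  rewrite ipDl !ipDr ip_Kuu [ip (K w) (u q)]hK [ip w (K _)]ipC Kuw.
  by field.
- apply: (smallest_sub (smallest_sigma_algebra _ _) _ sA).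
  move=> _ [i [c [iq ->]]]; apply: sub_sigma_algebra.
  by exists (gamma i), c; rewrite Pq_gamma.
Qed.

Let L_AMGM q (t : R) (A : set (borel H)) x : 0 < t ->
  L q x * \1_A x <= t / 2 * \1_A x + (2 * t)^-1 * expR (2 * (ip x (u q) -
     (ip (m 0) (u q) + S q / 2))).
Proof.
move=> t0; set y := expR (2 * _).
have yE : y = L q x ^+ 2 by rewrite /y /L -expRM_natl.
rewrite indicE; case: (x \in A); rewrite /= ?mulr1 ?mulr0 ?add0r; last first.
  by rewrite mulr_ge0 ?expR_ge0// invr_ge0 mulr_ge0// ltW.
rewrite -subr_ge0 yE.
have -> : t / 2 + (2 * t)^-1 * L q x ^+ 2 - L q x = (2 * t)^-1 * (t - L q x) ^+ 2.
  by field; rewrite gt_eqF.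
by rewrite mulr_ge0 ?sqr_ge0// invr_ge0 mulr_ge0// ltW.
Qed.

Let mcylinder q A : <<s cylinder q >> A -> measurable A.
Proof.
apply: smallest_sub; first exact: sigma_algebra_measurable.
move=> _ [i [c [_ ->]]].
have := @measurable_ip _ _ _ hip (gamma i) measurableT `]-oo, c[%classic (measurable_itv _).
by rewrite setTI; congr measurable; apply/seteqP; split => x /=; rewrite in_itv.
Qed.

Let cylinder_le q (t : R) A : 0 < t -> <<s cylinder q >> A ->
  (P1 A <= (t / 2)%:E * P0 A + ((2 * t)^-1 * expR (S q))%:E)%E.
Proof.
move=> t0 sA; have mA := mcylinder sA.
rewrite (cameron_martin sA).
have mi : measurable_fun setT (\1_A : borel H -> R) by exact: measurable_indic.
have me : measurable_fun setT (fun x : borel H =>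
    expR (2 * (ip x (u q) - (ip (m 0) (u q) + S q / 2)))).
  apply: measurableT_comp => //; apply: measurable_funM => //.
  by apply: measurable_funB => //; exact: measurable_ip.
have t2 : 0 <= t / 2 by rewrite divr_ge0// ltW.
have t3 : 0 <= (2 * t)^-1 by rewrite invr_ge0 mulr_ge0// ltW.
apply: (@le_trans _ _ (\int[P0]_x ((t / 2)%:E * (\1_A x)%:E +
   (2 * t)^-1%:E * (expR (2 * (ip x (u q) -
     (ip (m 0) (u q) + S q / 2))))%:E))%E).
  apply: ge0_le_integral => //.
  - by move=> x _; rewrite lee_fin mulr_ge0.
  - by apply/measurable_EFinP; apply: measurable_funM => //; exact: mL.
  - apply/measurable_EFinP; apply: measurable_funD; exact: measurable_funM.
  - by move=> x _; rewrite -!EFinM -EFinD lee_fin L_AMGM.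
rewrite ge0_integralD//; last 4 first.
- by move=> x _; rewrite -EFinM lee_fin mulr_ge0.
- by apply/measurable_EFinP; exact: measurable_funM.
- by move=> x _; rewrite -EFinM lee_fin mulr_ge0// expR_ge0.
- by apply/measurable_EFinP; exact: measurable_funM.
rewrite ge0_integralZl//; last exact/measurable_EFinP.
rewrite ge0_integralZl//; last exact/measurable_EFinP.
rewrite integral_indic// setIT integral_L_pow -EFinM.
rewrite (_ : 2 * _ + _ = S q)//; by field.
Qed.

Lemma not_mutually_singular_of_convergence (M : R) :
  (forall q, \sum_(j < q) nu_std j ^+ 2 <= M) ->
  ~ mutually_singular P0 P1.
Proof.
move=> SM [A [mA P0A P1A]].
(* Approximating for the sum of the measures yields one cylinder event B close to A under both. *)
pose mu := measure_add P0 P1.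
pose D := [set B : set (borel H) | exists q, <<s cylinder q >> B].
have cylS q q' : (q <= q')%N -> <<s cylinder q >> `<=` <<s cylinder q' >>.
  move=> qq'; apply: smallest_sub; first exact: smallest_sigma_algebra.
  by move=> B [i [c [iq ->]]]; apply: sub_sigma_algebra; exists i, c; split => //;
    exact: leq_trans qq'.
have sgD : <<s D >> A.
  have := borel_coord hip hgamma mA.
  apply: smallest_sub; first exact: smallest_sigma_algebra.
  move=> _ [i [c ->]]; apply: sub_sigma_algebra; exists i.+1.
  by apply: sub_sigma_algebra; exists i, c.
have muT : (mu setT < +oo)%E.
  rewrite /mu measure_addE; apply: lte_add_pinfty; rewrite -ge0_fin_numE//;
    exact: fin_num_measure.
(* This t makes the second term of [cylinder_le] at most 1/8, and e = 1/(4(t+1)) makes (t/2) e + e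
   at most 1/4; so 1 would be at most 3/8. *)
pose t := 4 * expR M.
have t0 : 0 < t by rewrite mulr_gt0// expR_gt0.
pose e := (4 * (t + 1))^-1.
have e0 : 0 < e by rewrite invr_gt0 mulr_gt0// addr_gt0.
have salg q : sigma_algebra setT <<s cylinder q >> by exact: smallest_sigma_algebra.
have DC : setC_closed D.
  by move=> B [q sB]; exists q; have [_ sC _] := salg q; rewrite -setTD; exact: sC.
have DU : setU_closed D.
  move=> B C [q sB] [q' sC]; exists (maxn q q').
  have [_ _ sU] := salg (maxn q q'); rewrite -bigcup2E; apply: sU => -[|[|n]] /=.
  - by apply: cylS sB; exact: leq_maxl.
  - by apply: cylS sC; exact: leq_maxr.
  - by have [] := salg (maxn q q').
have mD : D `<=` measurable by move=> B [q]; exact: mcylinder.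
have D0 : D set0 by exists 0%N; have [] := salg 0%N.
have [B [q sB]] := algebra_approximation muT mD D0 DC DU sgD e0.
rewrite /mu => muB.
have hB : (P0 ((A `\` B) `|` (B `\` A)) + P1 ((A `\` B) `|` (B `\` A)) <= e%:E)%E.
  by rewrite -(measure_addE P0 P1); exact: muB.
have mB := mcylinder sB.
have mAB : measurable (A `\` B) by exact: measurableD.
have mBA : measurable (B `\` A) by exact: measurableD.
have mAsB : measurable ((A `\` B) `|` (B `\` A)) by exact: measurableU.
have hl l : (P l ((A `\` B) `|` (B `\` A)) <= e%:E)%E.
  apply: le_trans hB; have : l = 0%R \/ l = 1%R.
    case: l => -[|[|//]] i; [left|right]; exact: val_inj.
  by case=> ->; rewrite ?leeDl ?leeDr.
have hP0 : (P0 B <= e%:E)%E.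
  apply: (@le_trans _ _ (P0 (A `|` (B `\` A)))).
    apply: le_measure; rewrite ?inE//; first exact: measurableU.
    by move=> x Bx; have [Ax|nAx] := pselect (A x); [left|right].
  apply: (@le_trans _ _ (P0 A + P0 (B `\` A))%E); first exact: measureU2.
  rewrite P0A add0e.
  by apply: le_trans (hl 0%R); apply: le_measure; rewrite ?inE// => x ?; right.
have hP1 : (1 <= P1 B + e%:E)%E.
  apply: (@le_trans _ _ (P1 setT)); first by rewrite probability_setT.
  apply: (@le_trans _ _ (P1 (~` A `|` (B `|` (A `\` B))))).
    apply: le_measure; rewrite ?inE//.
      by apply: measurableU; [exact: measurableC|exact: measurableU].
    move=> x _; have [Ax|nAx] := pselect (A x); last by left.
    by right; have [Bx|nBx] := pselect (B x); [left|right].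
  apply: (@le_trans _ _ (P1 (~` A) + P1 (B `|` (A `\` B)))%E).
    by apply: measureU2; [exact: measurableC|exact: measurableU].
  rewrite P1A add0e.
  apply: (@le_trans _ _ (P1 B + P1 (A `\` B))%E); first exact: measureU2.
  rewrite leeD2l//; apply: le_trans (hl 1%R).
  by apply: le_measure; rewrite ?inE// => x ?; left.
have : (1%:E <= (t / 2 * e + (2 * t)^-1 * expR M + e)%:E)%E.
  apply: (le_trans hP1); rewrite EFinD leeD2r//.
  apply: (le_trans (cylinder_le t0 sB)); rewrite EFinD; apply: leeD.
    by rewrite [leRHS]EFinM lee_wpmul2l// lee_fin divr_ge0// ltW.
  rewrite lee_fin ler_wpM2l ?ler_expR ?SM//.
  by rewrite invr_ge0 mulr_ge0// ltW.
rewrite lee_fin leNgt => /negP; apply.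
have -> : (2 * t)^-1 * expR M = 1 / 8.
  by rewrite /t; field; rewrite gt_eqF// expR_gt0.
have h : t / 2 * e + e <= (t + 1) * e.
  by rewrite mulrDl mul1r lerD2r ler_wpM2r ?ltW//; lra.
have he : (t + 1) * e = 1 / 4.
  by rewrite /e; field; rewrite gt_eqF// addr_gt0.
rewrite he in h; lra.
Qed.

End common_covariance_dichotomy.

(** * Diagonal coefficients *)

Section diagonal_coefficients.
Context {R : realType} {H : completeNormedModType R}.
Variable ip : {dot H for idfun}.
Hypothesis hip : inner_product_norm ip.
Variable alpha : R.
Variables (K : {linear H -> H}) (gamma : nat -> H) (lam : nat -> R).
Hypothesis hgamma : orthonormal_basis ip gamma.
Hypothesis hlam : forall j, K (gamma j) = lam j *: gamma j.
Hypothesis lam_gt0 : forall j, 0 < lam j.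
Variables (m : 'I_2 -> H) (P : 'I_2 -> probability (borel H) R).
Hypothesis hP : forall l, gaussian ip (P l) (m l) K.
Context (d : measure_display) (T : measurableType d) (Pr : probability T R).
Variable X : 'I_2 -> {RV Pr >-> borel H}.
Hypothesis hX : forall l (A : set (borel H)), measurable A ->
  distribution Pr (X l) A = P l A.

Local Notation rho := (rho alpha).
Local Notation nu_std := (nu_std ip gamma lam m).

Let integral_X l (f : borel H -> R) : measurable_fun setT f ->
  (forall x, 0 <= f x) ->
  (\int[Pr]_w (f (X l w))%:E = \int[P l]_x (f x)%:E)%E.
Proof.
move=> mf f0; transitivity (\int[distribution Pr (X l)]_x (f x)%:E)%E.
  by rewrite ge0_integral_distribution//; exact/measurable_EFinP.
by apply: eq_measure_integral => A mA _; exact: hX.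
Qed.

Section moments.
Variables (l : 'I_2) (j : nat).

Let g (x : borel H) := ip x (gamma j) - ip (m l) (gamma j).
Let c := centering alpha l ^+ 2 * nu_std j ^+ 2.

Let V2E w : V2_diag ip alpha gamma lam m X l j w = g (X l w) ^+ 2 / lam j + c.
Proof.
by rewrite /V2_diag /zeta ipBl expr_div_n sqr_sqrtr// ltW.
Qed.

Let c_ge0 : 0 <= c. Proof. by rewrite mulr_ge0// sqr_ge0. Qed.

Let mg : measurable_fun setT g.
Proof. exact: measurable_ip_centered. Qed.

Let gmgf t : (\int[P l]_x (expR (t * g x))%:E = (expR (t ^+ 2 * lam j / 2))%:E)%E.
Proof.
by rewrite (gaussian_mgf hip (hP l)) hlam ipZl hgamma.1 eqxx mulr1.
Qed.

Let ig n : (P l).-integrable setT (EFin \o (fun x => g x ^+ n)).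
Proof. exact: gaussian_integrable_pow mg gmgf n. Qed.

Lemma expectation_V2_diag :
  ('E_Pr[V2_diag ip alpha gamma lam m X l j] = (1 + c)%:E)%E.
Proof.
have l0 : lam j != 0 by rewrite gt_eqF.
have [_ M2 _] := gaussian_moments mg gmgf.
rewrite unlock; under eq_integral do rewrite V2E.
rewrite (@integral_X l (fun x => g x ^+ 2 / lam j + c)); last 2 first.
- by apply: measurable_funD => //; apply: measurable_funM => //;
    exact: measurable_funX.
- by move=> x; rewrite addr_ge0// mulr_ge0 ?sqr_ge0// invr_ge0 ltW.
under eq_integral do rewrite EFinD mulrC EFinM.
rewrite integralD//; last 2 first.
- by apply: integrableZl => //; exact: ig.
- exact: finite_measure_integrable_cst.
rewrite integralZl//; last exact: ig.
rewrite M2 -EFinM mulVf// integral_cst//=.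
by rewrite [X in (_ * X)%E]probability_setT mule1.
Qed.

Lemma expectation_V2_diag_sqr :
  ('E_Pr[fun w => (V2_diag ip alpha gamma lam m X l j w ^+ 2)%R] =
   (3 + 2 * c + c ^+ 2)%:E)%E.
Proof.
have l0 : lam j != 0 by rewrite gt_eqF.
have [_ M2 M4] := gaussian_moments mg gmgf.
rewrite unlock; under eq_integral do rewrite V2E.
rewrite (@integral_X l (fun x => (g x ^+ 2 / lam j + c) ^+ 2)); last 2 first.
- apply: measurable_funX; apply: measurable_funD => //.
  by apply: measurable_funM => //; exact: measurable_funX.
- by move=> x; rewrite sqr_ge0.
have E x : ((g x ^+ 2 / lam j + c) ^+ 2)%:E =
    (((lam j ^+ 2)^-1)%:E * (g x ^+ 4)%:E +
     (2 * c / lam j)%:E * (g x ^+ 2)%:E + (c ^+ 2)%:E)%E.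
  by rewrite -!EFinM -!EFinD; congr EFin; field.
under eq_integral do rewrite E.
have i4 := @integrableZl _ _ _ (P l) setT measurableT (lam j ^+ 2)^-1 _ (ig 4).
have i2 := @integrableZl _ _ _ (P l) setT measurableT (2 * c / lam j) _ (ig 2).
rewrite integralD//; last 2 first.
- exact: integrableD.
- exact: finite_measure_integrable_cst.
rewrite integralD// !integralZl//; [|exact: ig|exact: ig].
rewrite M2 M4 -!EFinM integral_cst//= [X in (_ * X)%E]probability_setT mule1.
by rewrite -!EFinD; congr EFin; field.
Qed.

End moments.

(** The weights satisfy: the sum of pi_l a_l^2 is rho, and the sum of pi_l a_l^4 is rho (1 - 3 rho).
    In each class the two diagonal moments 3 + 2c + c^2 and (1 + c)^2 differ by the variance 2 of a
    squared standard Gaussian, so [kappa] and [kappaF] have the same excess over 3 and 1. *)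
Lemma kappaE j : kappa ip alpha gamma lam m X j =
  3 + (2 * rho * nu_std j ^+ 2 + rho * (1 - 3 * rho) * nu_std j ^+ 4).
Proof.
rewrite /kappa !big_ord_recl big_ord0 !expectation_V2_diag_sqr /=.
by rewrite /prior /centering /= /rho; ring.
Qed.

Lemma kappaFE j : kappaF ip alpha gamma lam m X j =
  1 + (2 * rho * nu_std j ^+ 2 + rho * (1 - 3 * rho) * nu_std j ^+ 4).
Proof.
rewrite /kappaF !big_ord_recl big_ord0 !expectation_V2_diag /=.
by rewrite /prior /centering /= /rho; ring.
Qed.

Let sum_Delta q :
  \sum_(j < q) (2 * rho * nu_std j ^+ 2 + rho * (1 - 3 * rho) * nu_std j ^+ 4) =
  Delta ip alpha gamma lam m q.
Proof. by rewrite big_split/= -!mulr_sumr. Qed.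

Lemma A4E q :
  A4 ip alpha gamma lam m X q = 3 + Delta ip alpha gamma lam m q.
Proof.
rewrite /A4 -sum_Delta; congr (_ + _).
by apply: eq_bigr => j _; rewrite kappaE addrC addKr.
Qed.

Lemma AFE q :
  AF ip alpha gamma lam m X q = 1 + Delta ip alpha gamma lam m q.
Proof.
rewrite /AF -sum_Delta; congr (_ + _).
by apply: eq_bigr => j _; rewrite kappaFE addrC addKr.
Qed.

End diagonal_coefficients.

(** * Growth of [Delta] and of the ratio *)

Section Delta_growth.
Context {R : realType} {H : completeNormedModType R}.
Variables (ip : {dot H for idfun}) (alpha : R).
Hypothesis halpha : 0 < alpha < 1.
Variables (gamma : nat -> H) (lam : nat -> R) (m : 'I_2 -> H).

Local Notation rho := (rho alpha).
Local Notation nu_std := (nu_std ip gamma lam m).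
Local Notation Delta := (Delta ip alpha gamma lam m).
Let S q := \sum_(j < q) nu_std j ^+ 2.

Let rho_gt0 : 0 < rho.
Proof. by case/andP: halpha => a0 a1; rewrite mulr_gt0// subr_gt0. Qed.

(** Since (1 - 2 alpha)^2 >= 0 means rho <= 1/4. The quartic sum therefore cannot cancel the
    quadratic one. *)
Let quartic_coef_gt0 : 0 < rho * (1 - 3 * rho).
Proof.
rewrite mulr_gt0// /rho.
have : 0 <= (1 - 2 * alpha) ^+ 2 by rewrite sqr_ge0.
by move=> h; lra.
Qed.

Lemma Delta_ge q : 2 * rho * S q <= Delta q.
Proof.
rewrite /Delta lerDl mulr_ge0 ?(ltW quartic_coef_gt0)//.
by apply: sumr_ge0 => j _; rewrite -[4%N]/(2 * 2)%N exprM sqr_ge0.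
Qed.

Let S_ge0 q : 0 <= S q. Proof. by apply: sumr_ge0 => j _; rewrite sqr_ge0. Qed.

Lemma Delta_ge0 q : 0 <= Delta q.
Proof. by apply: le_trans (Delta_ge q); rewrite mulr_ge0 ?S_ge0// mulr_ge0// ltW. Qed.

(** Each squared coordinate is at most [S q <= M], so the quartic sum is at most M S <= M^2. *)
Lemma Delta_le M q : S q <= M ->
  Delta q <= 2 * rho * M + rho * (1 - 3 * rho) * M ^+ 2.
Proof.
move=> SM; have M0 : 0 <= M by exact: le_trans SM.
apply: lerD; first by rewrite ler_wpM2l// mulr_ge0// ltW.
rewrite ler_wpM2l ?(ltW quartic_coef_gt0)// expr2.
apply: (@le_trans _ _ (M * S q)); last by rewrite ler_wpM2l.
rewrite mulr_sumr; apply: ler_sum => j _.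
rewrite (_ : nu_std j ^+ 4 = nu_std j ^+ 2 * nu_std j ^+ 2); last by ring.
rewrite ler_wpM2r ?sqr_ge0//; apply: le_trans SM.
rewrite /S (bigD1 j)//= lerDl; apply: sumr_ge0 => i _; exact: sqr_ge0.
Qed.

Lemma sum_nu_dichotomy :
  (exists M, forall q, S q <= M) \/ S q @[q --> \oo] --> +oo.
Proof.
have [|h] := pselect (exists M, forall q, S q <= M); [by left|right].
apply/cvgryPge => A.
have /existsNP[q /negP] : ~ forall q, S q <= A by move=> SA; apply: h; exists A.
rewrite -ltNge => /ltW Aq; exists q => // n /= qn; apply: (le_trans Aq).
rewrite /S -(subnKC qn) big_split_ord/= lerDl.
by apply: sumr_ge0 => j _; rewrite sqr_ge0.
Qed.

Lemma Delta_cvgy : S q @[q --> \oo] --> +oo -> Delta q @[q --> \oo] --> +oo.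
Proof.
move=> /cvgryPge Soo; apply/cvgryPge => A.
have := Soo (A / (2 * rho)); apply: filterS => q.
have r2 : 0 < 2 * rho by rewrite mulr_gt0.
by rewrite ler_pdivrMr// mulrC => h; exact: le_trans (Delta_ge q).
Qed.

Lemma ratio_sub1 q : (3 + Delta q) / (1 + Delta q) - 1 = 2 / (1 + Delta q).
Proof.
have := Delta_ge0 q => h; field.
by rewrite gt_eqF// ltr_pwDl.
Qed.

Lemma ratio_cvg1 : Delta q @[q --> \oo] --> +oo ->
  (3 + Delta q) / (1 + Delta q) @[q --> \oo] --> (1 : R).
Proof.
move=> /cvgryPge Doo; apply/cvgrPdist_le => e e0.
apply: filterS (Doo (2 / e)) => q h; rewrite distrC ratio_sub1.
have D1 : 0 < 1 + Delta q by rewrite ltr_pwDl// Delta_ge0.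
rewrite ger0_norm ?divr_ge0 ?(ltW D1)// ler_pdivrMr// mulrC.
by rewrite -ler_pdivrMr// (le_trans h)// lerDr.
Qed.

(** If S were bounded, [Delta] would be at most some C and the ratio would exceed 1 by at least 2/(1
    + C) for every q. *)
Lemma sum_nu_cvgy :
  (3 + Delta q) / (1 + Delta q) @[q --> \oo] --> (1 : R) ->
  S q @[q --> \oo] --> +oo.
Proof.
move=> r1; have [[M SM]|//] := sum_nu_dichotomy; exfalso.
set C := 2 * rho * M + rho * (1 - 3 * rho) * M ^+ 2.
have DC q : Delta q <= C by exact: Delta_le.
have C1 : 0 < 1 + C by rewrite ltr_pwDl// (le_trans (Delta_ge0 0)).
have [q _ /(_ q (leqnn q))] : \forall q \near \oo,
    `|1 - (3 + Delta q) / (1 + Delta q)| < 2 / (1 + C).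
  by move/cvgrPdist_lt : r1; apply; rewrite divr_gt0.
have D1 : 0 < 1 + Delta q by rewrite ltr_pwDl// Delta_ge0.
rewrite distrC ratio_sub1 ger0_norm ?divr_ge0 ?(ltW D1)//.
by rewrite ltr_pM2l// ltf_pV2 ?posrE// ltrD2l ltNge DC.
Qed.

End Delta_growth.

Theorem theorem3p6 (R : realType) (H : completeNormedModType R)
    (ip : {dot H for idfun}) (hip : inner_product_norm ip)
    (alpha : R) (halpha : 0 < alpha < 1)
    (K : {linear H -> H}) (hK : covariance_operator ip K)
    (gamma : nat -> H) (hgamma : orthonormal_basis ip gamma)
    (lam : nat -> R) (hlam : forall j, K (gamma j) = lam j *: gamma j)
    (lam_noninc : nonincreasing_seq lam) (lam_gt0 : forall j, 0 < lam j)
    (m : 'I_2 -> H) (P : 'I_2 -> probability (borel H) R)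
    (hP : forall l, gaussian ip (P l) (m l) K)
    (d : measure_display) (T : measurableType d) (Pr : probability T R)
    (X : 'I_2 -> {RV Pr >-> borel H})
    (hX : forall l (A : set (borel H)), measurable A ->
      distribution Pr (X l) A = P l A) :
  [<-> mutually_singular (P 0) (P 1);
       Delta ip alpha gamma lam m q @[q --> \oo] --> +oo;
       A4 ip alpha gamma lam m X q / AF ip alpha gamma lam m X q
         @[q --> \oo] --> (1 : R)] /\
  (mutually_singular (P 0) (P 1) <->
   asymp_equiv (A4 ip alpha gamma lam m X) (AF ip alpha gamma lam m X)).
Proof.
have [_ hKs _ _] := hK.
have E : (fun q => A4 ip alpha gamma lam m X q / AF ip alpha gamma lam m X q) =
    (fun q => (3 + Delta ip alpha gamma lam m q) /
              (1 + Delta ip alpha gamma lam m q)).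
  apply/funext => q.
  by rewrite (A4E hip _ hgamma hlam lam_gt0 hP hX)
    (AFE hip _ hgamma hlam lam_gt0 hP hX).
have equiv : [<-> mutually_singular (P 0) (P 1);
       Delta ip alpha gamma lam m q @[q --> \oo] --> +oo;
       A4 ip alpha gamma lam m X q / AF ip alpha gamma lam m X q
         @[q --> \oo] --> (1 : R)].
  tfae.
  - move=> sing; have [[M SM]|] := sum_nu_dichotomy ip gamma lam m.
      by have := not_mutually_singular_of_convergence hip hKs hgamma hlam lam_gt0
        hP SM.
    exact: Delta_cvgy.
  - by rewrite E; exact: ratio_cvg1.
  - rewrite E => /(sum_nu_cvgy halpha).
    exact: (mutually_singular_of_divergence hip hKs hgamma hlam lam_gt0 hP).
(* [asymp_equiv] unfolds to the third statement of the cycle, which has index 2. *)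
by split=> //; exact: (equiv 0 2)%N.
Qed.
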